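(* Let $f=h+\overline{g}$ be a sense-preserving harmonic mapping in $\mathbb{D}$ and $F=H+\overline{G}\in\mathcal{B}_{H}$ such that $h'\preceq H'$. Then $\|P_f\|\leq\|P_F\|+2$. Thus, $f$ is uniformly locally univalent in $\mathbb{D}$.
   Context: $\mathbb{D}=\{z\in\mathbb{C}:|z|<1\}$. A harmonic mapping in $\mathbb{D}$ is written $f=h+\overline{g}$ with $h,g$ analytic in $\mathbb{D}$, $g(0)=0$; it is sense-preserving if $|h'|^2-|g'|^2>0$ in $\mathbb{D}$. The pre-Schwarzian derivative and norm are $$P_f=\frac{h''\overline{h'}-g''\overline{g'}}{|h'|^2-|g'|^2},\qquad \|P_f\|=\sup_{z\in\mathbb{D}}(1-|z|^2)|P_f(z)|.$$ $\mathcal{H}$ is the set of sense-preserving harmonic mappings $F=H+\overline G$ in $\mathbb{D}$ with $H(0)=H'(0)-1=G(0)=0$, and $\mathcal{B}_H=\{F\in\mathcal{H}:\|P_F\|<\infty\}$. For analytic functions $u,U$ in $\mathbb{D}$, $u\preceq U$ ($u$ is weakly subordinate to $U$) means that there exists an analytic function $\phi:\mathbb{D}\to\mathbb{D}$ (not necessarily fixing $0$) such that $u=U\circ\phi$ in $\mathbb{D}$. Hyperbolic distance $d_h(z,a)=2\tanh^{-1}\left|\frac{z-a}{1-\overline{a}z}\right|$; $D_h(a,\rho)=\{z\in\mathbb{D}:d_h(z,a)<\rho\}$. A sense-preserving harmonic mapping $f$ is uniformly locally univalent (ULU) in $\mathbb{D}$ if $\inf_{z\in\mathbb{D}}\sup_{\rho_z>0}\{\rho_z:f\text{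 is univalent in }D_h(z,\rho_z)\}>0$. *)

(* Defs.v *)
From Stdlib Require Export Reals.
From Coquelicot Require Export Coquelicot.

Open Scope R_scope.

Definition in_disk (z : C) : Prop := Cmod z < 1.

(* Analytic means complex differentiable at every point of the open disk;
   [@ex_derive C_AbsRing] is the limit of complex difference quotients. *)
Definition analytic_on_disk (f : C -> C) : Prop :=
  forall z : C, in_disk z -> @ex_derive C_AbsRing C_NormedModule f z.

(* [C_derive f z] is a total operator, evaluated along the real direction; it is
   the complex derivative of [f] at [z] as soon as [f] is complex differentiable
   there (see [C_derive_correct]).  It is only used on functions analytic in the
   disk and on their derivatives. *)
Definition C_derive2 (f : C -> C) : C -> C := C_derive (C_derive f).

(* [f = h + conj g] in the disk: the canonical decomposition ([g 0 = 0]). *)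
Definition harmonic_mapping (f h g : C -> C) : Prop :=
  analytic_on_disk h /\ analytic_on_disk g /\ g (RtoC 0) = RtoC 0 /\
  (forall z : C, in_disk z -> f z = Cplus (h z) (Cconj (g z))).

Definition jacobian (h g : C -> C) (z : C) : R :=
  Cmod (C_derive h z) ^ 2 - Cmod (C_derive g z) ^ 2.

Definition sense_preserving_harmonic (f h g : C -> C) : Prop :=
  harmonic_mapping f h g /\ (forall z : C, in_disk z -> 0 < jacobian h g z).

(* The decomposition with [g 0 = 0] is unique, so the pre-Schwarzian of a
   harmonic mapping is given as a function of its analytic parts. *)
Definition pre_schwarzian (h g : C -> C) (z : C) : C :=
  ((C_derive2 h z * Cconj (C_derive h z) - C_derive2 g z * Cconj (C_derive g z))
   / RtoC (jacobian h g z))%C.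

Definition pre_schwarzian_norm (h g : C -> C) : Rbar :=
  Lub_Rbar (fun r : R => exists z : C, in_disk z /\
    r = (1 - Cmod z ^ 2) * Cmod (pre_schwarzian h g z)).

Definition class_H (F H G : C -> C) : Prop :=
  sense_preserving_harmonic F H G /\
  H (RtoC 0) = RtoC 0 /\ C_derive H (RtoC 0) = RtoC 1 /\ G (RtoC 0) = RtoC 0.

Definition class_BH (F H G : C -> C) : Prop :=
  class_H F H G /\ Rbar_lt (pre_schwarzian_norm H G) p_infty.

Definition weakly_subordinate (u U : C -> C) : Prop :=
  exists phi : C -> C,
    analytic_on_disk phi /\
    (forall z : C, in_disk z -> in_disk (phi z)) /\
    (forall z : C, in_disk z -> u z = U (phi z)).

(* Inverse hyperbolic tangent, for [-1 < x < 1]. *)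
Definition artanh (x : R) : R := / 2 * ln ((1 + x) / (1 - x)).

Definition hyp_dist (z a : C) : R :=
  2 * artanh (Cmod ((z - a) / (RtoC 1 - Cconj a * z))%C).

Definition hyp_disk (a : C) (rho : R) (z : C) : Prop :=
  in_disk z /\ hyp_dist z a < rho.

Definition univalent_on (D : C -> Prop) (f : C -> C) : Prop :=
  forall z w : C, D z -> D w -> f z = f w -> z = w.

(* The inner supremum is [p_infty] when [f] is univalent in the whole disk, so
   both bounds are taken in the extended reals. *)
Definition uniformly_locally_univalent (f : C -> C) : Prop :=
  Rbar_lt 0 (Rbar_glb (fun s : Rbar => exists z : C, in_disk z /\
    s = Lub_Rbar (fun rho : R => 0 < rho /\ univalent_on (hyp_disk z rho) f))).

(* Main.v *)
Require Import Defs.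
From Stdlib Require Import Lra Classical IndefiniteDescription.
From Stdlib Require Import ssreflect.

(** Write [om = g' / h'] for the dilatation of [f = h + conj g].  Then [om] is an
    analytic self-map of the disk and
      [P_f = h'' / h' - conj om * om' / (1 - |om|^2)].
    By the Schwarz-Pick inequality the second term, multiplied by [1 - |z|^2],
    is at most [|om| < 1] ([pre_schwarzian_approx]); so the pre-Schwarzians of
    [f] and of its analytic part differ by at most 1 after this weighting.  If
    [h' = H' o phi], then [h'' / h' = phi' * (H'' / H') o phi], and Schwarz-Pick
    for [phi] shows that the weighted bound for [H'' / H'] passes to [h'' / h']
    ([subordination_bound]).  Going from [F] to [H], from [H] to [h] and from [h]
    to [f] costs 1 + 0 + 1 = 2.

    Uniform local univalence comes from a bound
      [(1 - |z|^2) |h'' / h'| <= m].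
    Fix [a] in the disk and put [b = om a].  The affine change of variables
    [f - conj b * conj f = k + conj l], with [k = h - conj b * g] and
    [l = g - b * h], preserves coincidences of values of [f] and makes the
    dilatation [l' / k' = (om - b) / (1 - conj b * om)] vanish at [a].  On a
    Euclidean disk about [a] of radius [s (1 - |a|^2)], with [s] depending on [m]
    alone, Schwarz-Pick keeps this dilatation small, and the bound on [k'' / k']
    keeps [k'] close to [k' a].  Hence [k + conj l] is a small Lipschitz
    perturbation of the linear map [z |-> k' a * z], so it is injective there
    ([univalent_near_point]); and such a disk contains the hyperbolic disk of
    radius [2 artanh (s / 2)].

    The function theory rests on one integral formula: for [f] complex
    differentiable near the closed disk of centre [a] and radius [r],
      [f' a] is the mean over the circle [|z| = r] of [(f (a + z) - f a) / z]
    ([cauchy_derivative]).  The circle means of a function complex differentiable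
    in a punctured disk do not depend on the radius: in the logarithmic
    coordinate [z = exp w] this is Goursat's theorem on a rectangle of height
    [2 PI], the horizontal sides cancelling by periodicity.  As the radius tends
    to 0, the mean of the difference quotient tends to the derivative.  The
    formula yields Cauchy's estimate, hence Schwarz-Pick after composition with
    Moebius maps, and also the complex differentiability of [f']
    ([ex_Cderive_C_derive]). *)

Notation is_Cderive := (@is_derive C_AbsRing C_NormedModule).
Notation ex_Cderive := (@ex_derive C_AbsRing C_NormedModule).
Notation is_path_derive := (@is_derive R_AbsRing C_R_NormedModule).
Notation RIntC := (@RInt C_R_CompleteNormedModule).
Notation ex_RIntC := (@ex_RInt C_R_CompleteNormedModule).

(** * Complex derivatives *)

Lemma is_Cderive_eps (f : C -> C) (z l : C) :
  is_Cderive f z l <->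
  (forall eps : R, 0 < eps -> exists delta : R, 0 < delta /\
     forall w : C, Cmod (w - z) < delta ->
       Cmod (f w - f z - l * (w - z)) <= eps * Cmod (w - z)).
Proof.
split.
- move=> [_ H] eps Heps.
  have [d Hd] := H z (fun P HP => HP) (mkposreal eps Heps).
  exists d; split; first exact: cond_pos.
  move=> w Hw; move: (Hd w Hw).
  rewrite /minus /plus /opp /scal /= /mult /= (Cmult_comm l).
  by [].
- move=> H; split; first exact: is_linear_scal_l.
  move=> x Hx; have -> : x = z.
    by symmetry; apply: (is_filter_lim_locally_unique (K := C_AbsRing) (V := AbsRing_NormedModule C_AbsRing) z x).
  move=> eps; have [d [Hd H1]] := H eps (cond_pos eps).
  exists (mkposreal d Hd) => w Hw; move: (H1 w Hw).
  by rewrite (Cmult_comm l).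
Qed.

Lemma is_Cderive_const (c z : C) : is_Cderive (fun _ => c) z (RtoC 0).
Proof. exact: is_derive_const. Qed.

Lemma is_Cderive_id (z : C) : is_Cderive (fun w => w) z (RtoC 1).
Proof.
apply/is_Cderive_eps => eps Heps; exists 1; split; first exact: Rlt_0_1.
move=> w _.
have -> : (w - z - RtoC 1 * (w - z) = RtoC 0)%C by ring.
by rewrite Cmod_0; apply: Rmult_le_pos; [lra | exact: Cmod_ge_0].
Qed.

Lemma is_Cderive_plus (f g : C -> C) (z lf lg : C) :
  is_Cderive f z lf -> is_Cderive g z lg ->
  is_Cderive (fun w => f w + g w)%C z (lf + lg)%C.
Proof. exact: is_derive_plus. Qed.

Lemma is_Cderive_minus (f g : C -> C) (z lf lg : C) :
  is_Cderive f z lf -> is_Cderive g z lg ->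
  is_Cderive (fun w => f w - g w)%C z (lf - lg)%C.
Proof. exact: is_derive_minus. Qed.

(** The generic product and chain rules see [C] as a module over itself, whose
    topology is packed differently from that of [C_NormedModule]; the derivative
    only involves the norm, which is the same. *)
Lemma is_Cderive_self (f : C -> C) (z l : C) :
  is_Cderive f z l <-> @is_derive C_AbsRing (AbsRing_NormedModule C_AbsRing) f z l.
Proof.
split; move=> [_ H]; (split; first exact: is_linear_scal_l); exact: H.
Qed.

Lemma is_Cderive_mult (f g : C -> C) (z lf lg : C) :
  is_Cderive f z lf -> is_Cderive g z lg ->
  is_Cderive (fun w => f w * g w)%C z (lf * g z + f z * lg)%C.
Proof.
move=> /is_Cderive_self Hf /is_Cderive_self Hg; apply/is_Cderive_self.
by apply: (@is_derive_mult C_AbsRing f g z lf lg Hf Hg) => n m; exact: Cmult_comm.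
Qed.

Lemma is_Cderive_comp (f g : C -> C) (z lf lg : C) :
  is_Cderive f (g z) lf -> is_Cderive g z lg ->
  is_Cderive (fun w => f (g w)) z (lf * lg)%C.
Proof.
move=> Hf /is_Cderive_self Hg; rewrite Cmult_comm.
exact: (@is_derive_comp C_AbsRing C_NormedModule f g z lf lg Hf Hg).
Qed.

Lemma is_Cderive_ext_ball (f g : C -> C) (z l : C) (d : R) :
  0 < d -> (forall w, Cmod (w - z) < d -> f w = g w) ->
  is_Cderive f z l -> is_Cderive g z l.
Proof.
move=> Hd E; apply: is_derive_ext_loc.
by exists (mkposreal d Hd) => w Hw; exact: (E w).
Qed.

Lemma is_Cderive_val (f : C -> C) (z l l' : C) :
  l = l' -> is_Cderive f z l -> is_Cderive f z l'.
Proof. by move=> ->. Qed.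

Lemma Cmod_sub_sym (z w : C) : Cmod (z - w) = Cmod (w - z).
Proof. by rewrite -Cmod_opp; congr Cmod; ring. Qed.

Lemma Cmod_sub_ge (z w : C) : Cmod z - Cmod w <= Cmod (z - w).
Proof.
have := Cmod_triangle (z - w) w.
have -> : (z - w + w = z)%C by ring.
lra.
Qed.

Lemma Cmod_sub_le (z w : C) : Cmod (z - w) <= Cmod z + Cmod w.
Proof. by rewrite -(Cmod_opp w); exact: Cmod_triangle. Qed.

Lemma is_Cderive_inv (z : C) : z <> RtoC 0 ->
  is_Cderive Cinv z (- / (z * z))%C.
Proof.
move=> Hz; have Pz := proj1 (Cmod_gt_0 z) Hz.
apply/is_Cderive_eps => eps Heps.
set m := Cmod z in Pz *.
have Hm3 : 0 < m * m * m by apply: Rmult_lt_0_compat => //; exact: Rmult_lt_0_compat.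
exists (Rmin (m / 2) (eps * (m * m * m) / 2)); split.
  apply: Rmin_glb_lt; first lra.
  have := Rmult_lt_0_compat _ _ Heps Hm3; lra.
move=> w Hw.
have H1 := Rlt_le_trans _ _ _ Hw (Rmin_l _ _).
have H2 := Rlt_le_trans _ _ _ Hw (Rmin_r _ _).
have Hwm : m / 2 < Cmod w.
  have := Cmod_sub_ge z w; rewrite Cmod_sub_sym -/m; lra.
have Hw0 : w <> RtoC 0 by apply/Cmod_gt_0; lra.
have -> : (/ w - / z - - / (z * z) * (w - z) = (w - z) * ((w - z) / (w * (z * z))))%C
  by field.
rewrite Cmod_mult (Rmult_comm eps); apply: Rmult_le_compat_l; first exact: Cmod_ge_0.
rewrite Cmod_div; last by do 2 (apply: Cmult_neq_0 => //).
rewrite !Cmod_mult -/m.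
have Hp : 0 < Cmod w * (m * m) by nra.
apply: (Rmult_le_reg_r _ _ _ Hp); rewrite /Rdiv Rmult_assoc Rinv_l; last lra.
have Hem : 0 < eps * (m * m) by nra.
have := Rmult_lt_compat_l _ _ _ Hem Hwm; lra.
Qed.

Lemma is_Cderive_div (f g : C -> C) (z lf lg : C) :
  g z <> RtoC 0 -> is_Cderive f z lf -> is_Cderive g z lg ->
  is_Cderive (fun w => f w / g w)%C z ((lf * g z - f z * lg) / (g z * g z))%C.
Proof.
move=> Hg Hf Hg'.
have Hi := is_Cderive_comp Cinv g z _ _ (is_Cderive_inv _ Hg) Hg'.
apply: is_Cderive_val (is_Cderive_mult f _ z _ _ Hf Hi).
by field.
Qed.

Lemma is_Cderive_scal (f : C -> C) (z l c : C) :
  is_Cderive f z l -> is_Cderive (fun w => c * f w)%C z (c * l)%C.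
Proof.
move=> Hf; apply: is_Cderive_val (is_Cderive_mult _ _ z _ _ (is_Cderive_const c z) Hf).
by ring.
Qed.

Lemma is_path_derive_eps (g : R -> C) (t : R) (v : C) :
  is_path_derive g t v <->
  (forall eps : R, 0 < eps -> exists delta : R, 0 < delta /\ forall s : R, Rabs (s - t) < delta ->
       Cmod (g s - g t - RtoC (s - t) * v) <= eps * Rabs (s - t)).
Proof.
split.
- move=> [_ H] eps Heps.
  have [d Hd] := H t (fun P HP => HP) (mkposreal eps Heps).
  exists d; split; first exact: cond_pos.
  move=> w Hw; move: (Hd w Hw).
  rewrite -!Cmod_norm /minus /plus /opp /= scal_R_Cmult.
  by [].
- move=> H; split; first exact: is_linear_scal_l.
  move=> x Hx; have -> : x = t.
    by symmetry; apply: (is_filter_lim_locally_unique t x).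
  move=> eps; have [d [Hd H1]] := H eps (cond_pos eps).
  exists (mkposreal d Hd) => w Hw; move: (H1 w Hw).
  rewrite -!Cmod_norm /minus /plus /opp /= scal_R_Cmult.
  by [].
Qed.

(** With [e1] controlling [f] and [e2] controlling [g], the error is
    [e1 |g s - g t| + |l| e2 |s - t|], where [|g s - g t| <= (|v| + e2) |s - t|]. *)
Lemma is_path_derive_comp (f : C -> C) (g : R -> C) (t : R) (l v : C) :
  is_Cderive f (g t) l -> is_path_derive g t v ->
  is_path_derive (fun s => f (g s)) t (l * v)%C.
Proof.
move=> /is_Cderive_eps Hf /is_path_derive_eps Hg; apply/is_path_derive_eps => eps Heps.
have Hv := Cmod_ge_0 v; have Hl := Cmod_ge_0 l.
have He1 : 0 < eps / (2 * (Cmod v + 1)) by apply: Rdiv_lt_0_compat; lra.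
have He2 : 0 < Rmin 1 (eps / (2 * (Cmod l + 1))).
  by apply: Rmin_glb_lt; [lra | apply: Rdiv_lt_0_compat; lra].
have [d1 [Hd1 H1]] := Hf _ He1.
have [d2 [Hd2 H2]] := Hg _ He2.
set e1 := eps / (2 * (Cmod v + 1)) in He1 H1.
set e2 := Rmin 1 _ in He2 H2.
have E1 : e1 * (Cmod v + 1) = eps / 2 by rewrite /e1; field; lra.
have E2 : e2 * (Cmod l + 1) <= eps / 2.
  have -> : eps / 2 = eps / (2 * (Cmod l + 1)) * (Cmod l + 1) by field; lra.
  apply: Rmult_le_compat_r; [lra | exact: Rmin_r].
have E3 : e2 <= 1 by exact: Rmin_l.
exists (Rmin d2 (d1 / (Cmod v + 1))); split.
  by apply: Rmin_glb_lt => //; apply: Rdiv_lt_0_compat; lra.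
move=> s Hs.
have Hs2 := Rlt_le_trans _ _ _ Hs (Rmin_l _ _).
have Hs1 := Rlt_le_trans _ _ _ Hs (Rmin_r _ _).
have K2 := H2 s Hs2.
have Hx := Rabs_pos (s - t).
have K : Cmod (g s - g t) <= (Cmod v + 1) * Rabs (s - t).
  have := Cmod_triangle (g s - g t - RtoC (s - t) * v) (RtoC (s - t) * v).
  have -> : (g s - g t - RtoC (s - t) * v + RtoC (s - t) * v = g s - g t)%C by ring.
  rewrite Cmod_mult Cmod_R; nra.
have K1 : Cmod (g s - g t) < d1.
  apply: Rle_lt_trans K _.
  have -> : d1 = (Cmod v + 1) * (d1 / (Cmod v + 1)) by field; lra.
  by apply: Rmult_lt_compat_l => //; lra.
have {}K1 := H1 _ K1.
have -> : (f (g s) - f (g t) - RtoC (s - t) * (l * v) =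
   (f (g s) - f (g t) - l * (g s - g t)) + l * (g s - g t - RtoC (s - t) * v))%C by ring.
apply: Rle_trans (Cmod_triangle _ _) _; rewrite Cmod_mult.
have : e1 * Cmod (g s - g t) <= e1 * ((Cmod v + 1) * Rabs (s - t)).
  by apply: Rmult_le_compat_l => //; lra.
have : Cmod l * Cmod (g s - g t - RtoC (s - t) * v) <= Cmod l * (e2 * Rabs (s - t)).
  by apply: Rmult_le_compat_l.
have -> : e1 * ((Cmod v + 1) * Rabs (s - t)) = eps / 2 * Rabs (s - t).
  by rewrite -E1; ring.
have : Cmod l * e2 * Rabs (s - t) <= eps / 2 * Rabs (s - t).
  by apply: Rmult_le_compat_r => //; lra.
lra.
Qed.

Lemma is_path_derive_segment (z v : C) (t : R) :
  is_path_derive (fun s => z + RtoC s * v)%C t v.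
Proof.
apply/is_path_derive_eps => eps Heps; exists 1; split; first lra.
move=> s _.
have -> : (z + RtoC s * v - (z + RtoC t * v) - RtoC (s - t) * v = RtoC 0)%C.
  by rewrite RtoC_minus; ring.
rewrite Cmod_0; have := Rabs_pos (s - t); nra.
Qed.

Lemma is_derive_Re_path (u : C) (g : R -> C) (t : R) (v : C) :
  is_path_derive g t v -> is_derive (fun s => Re (u * g s)%C) t (Re (u * v)%C).
Proof.
move=> H.
have Hu : is_path_derive (fun s => u * g s)%C t (u * v)%C.
  apply: is_path_derive_comp H.
  by apply: is_Cderive_val (is_Cderive_scal _ _ _ u (is_Cderive_id _)); ring.

move/is_path_derive_eps: Hu => Hu.
split; first exact: is_linear_scal_l.
move=> x Hx; have -> : x = t.
  by symmetry; apply: (is_filter_lim_locally_unique t x).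
move=> eps; have [d [Hd H1]] := Hu eps (cond_pos eps).
exists (mkposreal d Hd) => s Hs.
apply: Rle_trans (H1 s Hs); apply: Rle_trans (re_le_Cmod _).
rewrite /minus /plus /opp /scal /= /mult /= /norm /= /abs /=.
by apply: Req_le; congr Rabs; ring.
Qed.

Lemma is_derive_continuity_pt (f : R -> R) (t l : R) :
  is_derive f t l -> continuity_pt f t.
Proof.
move=> H; apply/continuity_pt_filterlim.
by apply: (ex_derive_continuous f t); exists l.
Qed.

(** With [D = f w - f z], the real mean value theorem applies to the real part of
    [conj D * f] along the segment, whose total increment is [|D|^2]. *)
Lemma mean_value_segment (f : C -> C) (z w : C) (K : R) :
  (forall t, 0 <= t <= 1 ->
     ex_derive (K := C_AbsRing) (V := C_NormedModule) f (z + RtoC t * (w - z))%C /\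
     Cmod (C_derive f (z + RtoC t * (w - z))%C) <= K) ->
  Cmod (f w - f z) <= K * Cmod (w - z).
Proof.
move=> H.
set D := (f w - f z)%C.
set p := fun t : R => (z + RtoC t * (w - z))%C.
set phi := fun t : R => Re (Cconj D * f (p t))%C.
set dphi := fun t : R => Re (Cconj D * (C_derive f (p t) * (w - z)))%C.
have Hphi t : 0 <= t <= 1 -> is_derive phi t (dphi t).
  move=> Ht; apply: is_derive_Re_path; apply: is_path_derive_comp.
    exact: C_derive_correct (RtoC 0) (proj1 (H t Ht)).
  exact: is_path_derive_segment.
have [c [Hc E]] : exists c, 0 <= c <= 1 /\ phi 1 - phi 0 = dphi c * (1 - 0).
  have := MVT_gen phi 0 1 dphi; rewrite /= Rmin_left ?Rmax_right; try lra.
  apply=> t Ht; first by apply: Hphi; lra.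
  exact: is_derive_continuity_pt (Hphi t Ht).
have E2 : phi 1 - phi 0 = Cmod D * Cmod D.
  have -> : Cmod D * Cmod D = Cmod D ^ 2 by ring.
  have -> : phi 1 - phi 0 = Re (Cconj D * D)%C.
    rewrite /phi /p /D.
    have -> : (z + RtoC 1 * (w - z) = w)%C by ring.
    have -> : (z + RtoC 0 * (w - z) = z)%C by ring.
    by rewrite /=; ring.
  by rewrite Cmult_comm -Cmod2_conj.
have E3 : dphi c <= Cmod D * (K * Cmod (w - z)).
  apply: Rle_trans (Rle_abs _) _; apply: Rle_trans (re_le_Cmod _) _.
  rewrite !Cmod_mult Cmod_conj.
  apply: Rmult_le_compat_l; first exact: Cmod_ge_0.
  apply: Rmult_le_compat_r; first exact: Cmod_ge_0.
  exact: proj2 (H c Hc).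
have [->|HD] := Req_dec (Cmod D) 0.
  apply: Rmult_le_pos (Cmod_ge_0 _).
  apply: Rle_trans (Cmod_ge_0 _) (proj2 (H 0 _)); lra.
apply: (Rmult_le_reg_l (Cmod D)); first by have := Cmod_ge_0 D; lra.
lra.
Qed.

(** * Goursat's theorem on rectangles *)

(** If the conclusion fails, one of the four quarters is bad again; iterating
    gives nested bad rectangles shrinking to a point, where the local
    hypothesis contradicts their badness. *)
Lemma rectangle_bisection (P : R -> R -> R -> R -> Prop) (a b c d : R) :
  a <= b -> c <= d ->
  (forall a' b' c' d', a <= a' <= b' /\ b' <= b -> c <= c' <= d' /\ d' <= d ->
     let m := (a' + b') / 2 in let n := (c' + d') / 2 in
     P a' m c' n -> P m b' c' n -> P a' m n d' -> P m b' n d' -> P a' b' c' d') ->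
  (forall x y, a <= x <= b -> c <= y <= d ->
     exists delta : R, 0 < delta /\ forall a' b' c' d',
       a <= a' <= x /\ x <= b' <= b -> c <= c' <= y /\ y <= d' <= d ->
       b' - a' < delta -> d' - c' < delta -> P a' b' c' d') ->
  P a b c d.
Proof.
move=> Hab Hcd Hsub Hloc; apply: NNPP => HN.
pose bad q := match q with (((a', b'), c'), d') =>
  (a <= a' <= b' /\ b' <= b) /\ (c <= c' <= d' /\ d' <= d) /\ ~ P a' b' c' d' end.
pose half q q' := match q, q' with (((a1, b1), c1), d1), (((a2, b2), c2), d2) =>
  a1 <= a2 /\ b2 <= b1 /\ c1 <= c2 /\ d2 <= d1 /\ b2 - a2 = (b1 - a1) / 2 /\
  d2 - c2 = (d1 - c1) / 2 end.
have Hstep q : exists q', bad q -> bad q' /\ half q q'.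
  case: (classic (bad q)) => [Hq|Hq]; last by exists q.
  case: q Hq => [[[a1 b1] c1] d1] [Ha [Hc HP]].
  set m := (a1 + b1) / 2; set n := (c1 + d1) / 2.
  apply: NNPP => Hno.
  have Hq a2 b2 c2 d2 : a1 <= a2 -> b2 <= b1 -> c1 <= c2 -> d2 <= d1 ->
      b2 - a2 = (b1 - a1) / 2 -> d2 - c2 = (d1 - c1) / 2 -> P a2 b2 c2 d2.
    move=> *; apply: NNPP => HP2; apply: Hno; exists (((a2, b2), c2), d2) => _.
    split; rewrite /bad /half; repeat split => //; lra.
  apply: HP; apply: Hsub => //; apply: Hq; rewrite /m /n; lra.
pose F q := proj1_sig (constructive_indefinite_description _ (Hstep q)).
have HF q : bad q -> bad (F q) /\ half q (F q).
  exact: (proj2_sig (constructive_indefinite_description _ (Hstep q))).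
pose Q := fix Q (k : nat) := match k with O => (((a, b), c), d) | S k' => F (Q k') end.
have Qbad k : bad (Q k).
  elim: k => [|k IH] /=; first by repeat split; try lra.
  exact: proj1 (HF _ IH).
pose A k := fst (fst (fst (Q k))); pose B k := snd (fst (fst (Q k))).
pose Cc k := snd (fst (Q k)); pose D k := snd (Q k).
have QE k : Q k = (((A k, B k), Cc k), D k).
  by rewrite /A /B /Cc /D; case: (Q k) => [[[? ?] ?] ?].
have Hb k : (a <= A k <= B k /\ B k <= b) /\ (c <= Cc k <= D k /\ D k <= d) /\
    ~ P (A k) (B k) (Cc k) (D k).
  by have := Qbad k; rewrite QE.
have Hh k : A k <= A (S k) /\ B (S k) <= B k /\ Cc k <= Cc (S k) /\ D (S k) <= D k /\
    B (S k) - A (S k) = (B k - A k) / 2 /\ D (S k) - Cc (S k) = (D k - Cc k) / 2.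
  have := proj2 (HF _ (Qbad k)); rewrite -/(Q (S k)) !QE; exact.
(* nested intervals have a common point: the supremum of the left ends *)
have common (L U : nat -> R) : (forall k, L k <= U k) ->
    (forall k, L k <= L (S k)) -> (forall k, U (S k) <= U k) ->
    exists x, forall k, L k <= x <= U k.
  move=> HLU HL HU.
  have mL j k : L k <= L (k + j)%nat.
    elim: j => [|j IH]; first by rewrite Nat.add_0_r; lra.
    rewrite Nat.add_succ_r; have := HL (k + j)%nat; lra.
  have mU j k : U (k + j)%nat <= U k.
    elim: j => [|j IH]; first by rewrite Nat.add_0_r; lra.
    rewrite Nat.add_succ_r; have := HU (k + j)%nat; lra.
  have H k j : L k <= U j.
    have := mL j k; have := mU k j; have := HLU (k + j)%nat.
    rewrite (Nat.add_comm j k); lra.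
  have [x [Hx1 Hx2]] : {x | is_lub (fun r => exists k, r = L k) x}.
    apply: completeness; last by exists (L O), O.
    by exists (U O) => r [k ->].
  exists x => k; split; first by apply: Hx1; exists k.
  by apply: Hx2 => r [j ->].
have [x Hx] : exists x, forall k, A k <= x <= B k.
  by apply: common => k; [have := Hb k | have := Hh k | have := Hh k]; lra.
have [y Hy] : exists y, forall k, Cc k <= y <= D k.
  by apply: common => k; [have := Hb k | have := Hh k | have := Hh k]; lra.
have Hw k : B k - A k = (b - a) * (/ 2) ^ k /\ D k - Cc k = (d - c) * (/ 2) ^ k.
  elim: k => [|k IH]; first by rewrite /A /B /Cc /D /=; lra.
  have [_ [_ [_ [_ [-> ->]]]]] := Hh k; case: IH => -> ->; rewrite /=; lra.
have [delta [Hd HP]] : exists delta, 0 < delta /\ forall a' b' c' d',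
    a <= a' <= x /\ x <= b' <= b -> c <= c' <= y /\ y <= d' <= d ->
    b' - a' < delta -> d' - c' < delta -> P a' b' c' d'.
  by apply: Hloc; [have := Hx O | have := Hy O]; rewrite /A /B /Cc /D /=; lra.
have [k Hk] : exists k, ((b - a) + (d - c)) * (/ 2) ^ k < delta.
  have Hs : 0 < b - a + (d - c) + 1 by lra.
  have H2 : Rabs (/ 2) < 1 by rewrite Rabs_pos_eq; lra.
  have [k Hk] := pow_lt_1_zero _ H2 _ (Rdiv_lt_0_compat _ _ Hd Hs).
  exists k; have {Hk} := Hk k (le_n k).
  have Hp : 0 < (/ 2) ^ k by apply: pow_lt; lra.
  rewrite Rabs_pos_eq; last lra.
  move=> H; have := Rmult_lt_compat_l _ _ _ Hs H.
  have -> : (b - a + (d - c) + 1) * (delta / (b - a + (d - c) + 1)) = delta by field; lra.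
  nra.
have [H1 [H2 H3]] := Hb k.
have Hp : 0 < (/ 2) ^ k by apply: pow_lt; lra.
have [E1 E2] := Hw k.
apply: H3; apply: HP; have := Hx k; have := Hy k; lra.
Qed.

(** The integral of [g] along the boundary of [[a, b] x [c, d]], counterclockwise. *)
Definition rect_int (g : C -> C) (a b c d : R) : C :=
  (RIntC (fun x => g (x, c)) a b - RIntC (fun x => g (x, d)) a b
   + Ci * (RIntC (fun y => g (b, y)) c d - RIntC (fun y => g (a, y)) c d))%C.

Definition sides_integrable (g : C -> C) (a b c d : R) : Prop :=
  (forall y, c <= y <= d -> forall a' b', a <= a' -> a' <= b' -> b' <= b ->
     ex_RIntC (fun x => g (x, y)) a' b') /\
  (forall x, a <= x <= b -> forall c' d', c <= c' -> c' <= d' -> d' <= d ->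
     ex_RIntC (fun y => g (x, y)) c' d').

Lemma rect_int_quadrants (g : C -> C) (a m b c n d : R) :
  a <= m <= b -> c <= n <= d -> sides_integrable g a b c d ->
  rect_int g a b c d =
    (rect_int g a m c n + rect_int g m b c n
     + (rect_int g a m n d + rect_int g m b n d))%C.
Proof.
move=> Hm Hn [H1 H2]; rewrite /rect_int.
have EX y : c <= y <= d -> RIntC (fun x => g (x, y)) a b =
   (RIntC (fun x => g (x, y)) a m + RIntC (fun x => g (x, y)) m b)%C.
  move=> Hy; symmetry; apply: (RInt_Chasles (V := C_R_CompleteNormedModule)); apply: H1; lra.
have EY x : a <= x <= b -> RIntC (fun y => g (x, y)) c d =
   (RIntC (fun y => g (x, y)) c n + RIntC (fun y => g (x, y)) n d)%C.
  move=> Hx; symmetry; apply: (RInt_Chasles (V := C_R_CompleteNormedModule)); apply: H2; lra.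
rewrite !EX ?EY; try lra.
ring.
Qed.

Lemma is_path_derive_horizontal (x y : R) :
  is_path_derive (fun s => (s, y) : C) x (RtoC 1).
Proof.
apply: is_derive_ext (is_path_derive_segment (0, y) (RtoC 1) x) => t.
by rewrite /RtoC /Cplus /Cmult /=; congr pair; ring.
Qed.

Lemma is_path_derive_vertical (x y : R) :
  is_path_derive (fun s => (x, s) : C) y Ci.
Proof.
apply: is_derive_ext (is_path_derive_segment (RtoC x) Ci y) => t.
by rewrite /RtoC /Ci /Cplus /Cmult /=; congr pair; ring.
Qed.

Lemma continuous_path_comp (f : C -> C) (g : R -> C) (t : R) (v : C) :
  ex_Cderive f (g t) -> is_path_derive g t v ->
  @continuous R_UniformSpace C_R_NormedModule (fun s => f (g s)) t.
Proof.
move=> [l Hl] Hg; apply: ex_derive_continuous.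
by exists (l * v)%C; exact: is_path_derive_comp.
Qed.

Lemma RIntC_minus (f g : R -> C) (a b : R) :
  ex_RIntC f a b -> ex_RIntC g a b ->
  RIntC (fun t => f t - g t)%C a b = (RIntC f a b - RIntC g a b)%C.
Proof. exact: RInt_minus. Qed.

Lemma Cmod_RIntC_le (f : R -> C) (a b M : R) :
  a <= b -> ex_RIntC f a b -> (forall t, a <= t <= b -> Cmod (f t) <= M) ->
  Cmod (RIntC f a b) <= (b - a) * M.
Proof.
move=> Hab Hf HM; rewrite Cmod_norm.
apply: (norm_RInt_le_const f a b _ M Hab); last exact: (RInt_correct (V := C_R_CompleteNormedModule)).
by move=> x Hx; rewrite -Cmod_norm; exact: HM.
Qed.

Lemma RIntC_path_derive (G g : C -> C) (p : R -> C) (a b : R) (v : C) :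
  v <> RtoC 0 -> (forall w, is_Cderive G w (g w)) -> (forall w, ex_Cderive g w) ->
  (forall t, is_path_derive p t v) ->
  RIntC (fun t => g (p t)) a b = (/ v * G (p b) - / v * G (p a))%C.
Proof.
move=> Hv HG Hg Hp; apply: (is_RInt_unique (V := C_R_CompleteNormedModule)).
apply: (is_RInt_derive (V := C_R_CompleteNormedModule) (fun t => / v * G (p t))%C) => t _.
- have -> : g (p t) = (/ v * g (p t) * v)%C by field.
  exact: (is_path_derive_comp (fun w => / v * G w)%C) (is_Cderive_scal _ _ _ _ (HG _)) (Hp t).
- exact: continuous_path_comp (Hg _) (Hp t).
Qed.

Lemma rect_int_primitive (g G : C -> C) (a b c d : R) :
  (forall w, is_Cderive G w (g w)) -> (forall w, ex_Cderive g w) ->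
  rect_int g a b c d = RtoC 0.
Proof.
move=> HG Hg; rewrite /rect_int.
have H1 : RtoC 1 <> RtoC 0 by apply/Cmod_gt_0; rewrite Cmod_1; lra.
have Hi : Ci <> RtoC 0 by apply/Cmod_gt_0; rewrite Cmod_Ci; lra.
have HX y : RIntC (fun x => g (x, y)) a b = (G (b, y) - G (a, y))%C.
  rewrite (RIntC_path_derive G g (fun x => (x, y) : C) a b (RtoC 1)) //.
    by change (/ RtoC 1 * G (b, y) - / RtoC 1 * G (a, y) = G (b, y) - G (a, y))%C; field.
  by move=> t; exact: is_path_derive_horizontal.
have HY x : RIntC (fun y => g (x, y)) c d = (/ Ci * G (x, d) - / Ci * G (x, c))%C.
  apply: (RIntC_path_derive G g (fun y => (x, y) : C) c d Ci) => //.
  by move=> t; exact: is_path_derive_vertical.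
rewrite !HX !HY; field; exact: Hi.
Qed.

Lemma rect_int_le (g : C -> C) (a b c d M : R) :
  a <= b -> c <= d -> sides_integrable g a b c d ->
  (forall x y, a <= x <= b -> c <= y <= d -> Cmod (g (x, y)) <= M) ->
  Cmod (rect_int g a b c d) <= 2 * ((b - a) + (d - c)) * M.
Proof.
move=> Hab Hcd [H1 H2] HM; rewrite /rect_int.
apply: Rle_trans (Cmod_triangle _ _) _; rewrite Cmod_mult Cmod_Ci.
have := Cmod_sub_le (RIntC (fun x : R => g (x, c)) a b) (RIntC (fun x : R => g (x, d)) a b).
have := Cmod_sub_le (RIntC (fun y : R => g (b, y)) c d) (RIntC (fun y : R => g (a, y)) c d).
have HX y : c <= y <= d -> Cmod (RIntC (fun x => g (x, y)) a b) <= (b - a) * M.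
  by move=> Hy; apply: Cmod_RIntC_le => // [|t Ht]; [apply: H1 => //; lra | exact: HM].
have HY x : a <= x <= b -> Cmod (RIntC (fun y => g (x, y)) c d) <= (d - c) * M.
  by move=> Hx; apply: Cmod_RIntC_le => // [|t Ht]; [apply: H2 => //; lra | exact: HM].
have := HX c; have := HX d; have := HY a; have := HY b.
lra.
Qed.

Lemma rect_int_minus (f g : C -> C) (a b c d : R) :
  a <= b -> c <= d -> sides_integrable f a b c d -> sides_integrable g a b c d ->
  rect_int (fun w => f w - g w)%C a b c d = (rect_int f a b c d - rect_int g a b c d)%C.
Proof.
move=> Hab Hcd [F1 F2] [G1 G2]; rewrite /rect_int.
rewrite !RIntC_minus; try (apply: F1 || apply: F2 || apply: G1 || apply: G2); try lra.
ring.
Qed.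

Lemma sides_integrable_derive (g : C -> C) (a b c d : R) :
  (forall x y, a <= x <= b -> c <= y <= d -> ex_Cderive g (x, y)) ->
  sides_integrable g a b c d.
Proof.
move=> Hg; split.
- move=> y Hy a' b' H1 H2 H3; apply: (ex_RInt_continuous (V := C_R_CompleteNormedModule)) => x.
  rewrite Rmin_left ?Rmax_right // => Hx.
  apply: (continuous_path_comp g (fun s => (s, y) : C)); last exact: is_path_derive_horizontal.
  apply: Hg; lra.
- move=> x Hx c' d' H1 H2 H3; apply: (ex_RInt_continuous (V := C_R_CompleteNormedModule)) => y.
  rewrite Rmin_left ?Rmax_right // => Hy.
  apply: (continuous_path_comp g (fun s => (x, s) : C)); last exact: is_path_derive_vertical.
  apply: Hg; lra.
Qed.

Lemma Cmod_le_abs (x y : R) : Cmod (x, y) <= Rabs x + Rabs y.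
Proof.
have -> : (x, y) = (RtoC x + RtoC y * Ci)%C.
  by rewrite /RtoC /Ci /Cplus /Cmult /=; congr pair; ring.
apply: Rle_trans (Cmod_triangle _ _) _.
by rewrite Cmod_mult Cmod_Ci !Cmod_R Rmult_1_r; exact: Rle_refl.
Qed.

(** For every [K > 0] the boundary integral over a rectangle of half-perimeter [P]
    is at most [K P^2] in modulus: the bound is stable under quartering, because
    the quarters have half-perimeter [P / 2], and it holds near each point
    because [g] differs from its affine approximation there, which has a
    primitive, by [K / 2] times the distance. *)
Theorem goursat_rectangle (g : C -> C) (a b c d : R) :
  a <= b -> c <= d ->
  (forall x y, a <= x <= b -> c <= y <= d -> ex_Cderive g (x, y)) ->
  rect_int g a b c d = RtoC 0.
Proof.
move=> Hab Hcd Hg.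
have small K : 0 < K -> Cmod (rect_int g a b c d) <= K * ((b - a) + (d - c)) ^ 2.
  move=> HK.
  apply: (rectangle_bisection (fun a b c d =>
    Cmod (rect_int g a b c d) <= K * ((b - a) + (d - c)) ^ 2)) => // {Hab Hcd}.
  - move=> a' b' c' d' Ha Hc m n H1 H2 H3 H4.
    have HS : sides_integrable g a' b' c' d'.
      by apply: sides_integrable_derive => x y Hx Hy; apply: Hg; lra.
    rewrite (rect_int_quadrants g a' m b' c' n d') //; try by rewrite /m /n; lra.
    apply: Rle_trans (Cmod_triangle _ _) _.
    have := Cmod_triangle (rect_int g a' m c' n) (rect_int g m b' c' n).
    have := Cmod_triangle (rect_int g a' m n d') (rect_int g m b' n d').
    have E1 : m - a' + (n - c') = (b' - a' + (d' - c')) / 2 by rewrite /m /n; lra.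
    have E2 : b' - m + (n - c') = (b' - a' + (d' - c')) / 2 by rewrite /m /n; lra.
    have E3 : m - a' + (d' - n) = (b' - a' + (d' - c')) / 2 by rewrite /m /n; lra.
    have E4 : b' - m + (d' - n) = (b' - a' + (d' - c')) / 2 by rewrite /m /n; lra.
    move: H1 H2 H3 H4; rewrite E1 E2 E3 E4; lra.
  - move=> x y Hx Hy; have [l Hl] := Hg x y Hx Hy.
    have [|delta [Hd H]] := proj1 (is_Cderive_eps g (x, y) l) Hl (K / 2); first lra.
    exists (delta / 2); split; first lra.
    move=> a' b' c' d' Ha Hc Hwa Hwc.
    set T := fun w : C => (g (x, y) + l * (w - (x, y)))%C.
    have HT w : is_Cderive T w l.
      apply: is_Cderive_val (is_Cderive_plus _ _ _ _ _ (is_Cderive_const _ _)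
        (is_Cderive_scal _ _ _ l (is_Cderive_minus _ _ _ _ _ (is_Cderive_id w)
          (is_Cderive_const (x, y) w)))).
      ring.
    have IT : rect_int T a' b' c' d' = RtoC 0.
      apply: (rect_int_primitive T (fun w => g (x, y) * w +
         (l / RtoC 2) * ((w - (x, y)) * (w - (x, y))))%C); last by move=> w; exists l.
      move=> w.
      have Hm := is_Cderive_minus _ _ _ _ _ (is_Cderive_id w) (is_Cderive_const (x, y) w).
      apply: is_Cderive_val (is_Cderive_plus _ _ _ _ _ (is_Cderive_scal _ _ _ _ (is_Cderive_id _))
        (is_Cderive_scal _ _ _ (l / RtoC 2) (is_Cderive_mult _ _ _ _ _ Hm Hm))).
      rewrite /T; field; apply/Cmod_gt_0; rewrite Cmod_R Rabs_pos_eq; lra.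
    have Sg : sides_integrable g a' b' c' d'.
      by apply: sides_integrable_derive => u v Hu Hv; apply: Hg; lra.
    have ST : sides_integrable T a' b' c' d'.
      by apply: sides_integrable_derive => u v Hu Hv; exists l.
    have SD : sides_integrable (fun w => g w - T w)%C a' b' c' d'.
      apply: sides_integrable_derive => u v Hu Hv.
      have [|| lg Hlg] := Hg u v; try lra.
      by exists (lg - l)%C; exact: is_Cderive_minus.
    have -> : rect_int g a' b' c' d' = rect_int (fun w => g w - T w)%C a' b' c' d'.
      rewrite rect_int_minus //; try lra; rewrite IT; ring.
    set P := b' - a' + (d' - c').
    have -> : K * P ^ 2 = 2 * P * (K / 2 * P) by rewrite /=; field.
    apply: rect_int_le => //; try lra.
    move=> u v Hu Hv.
    have Hdist : Cmod ((u, v) - (x, y)) <= P.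
      apply: Rle_trans (Cmod_le_abs _ _) _.
      rewrite /=; apply: Rplus_le_compat; apply: Rabs_le; lra.
    have -> : (g (u, v) - T (u, v) = g (u, v) - g (x, y) - l * ((u, v) - (x, y)))%C.
      by rewrite /T; ring.
    apply: Rle_trans (H _ _) _; first by apply: Rle_lt_trans Hdist _; rewrite /P; lra.
    by apply: Rmult_le_compat_l => //; lra.
apply: Cmod_eq_0; apply: Rle_antisym (Cmod_ge_0 _).
apply: Rnot_lt_le => Hpos.
set I := Cmod _ in small Hpos; set P2 := (b - a + (d - c)) ^ 2 in small.
have HP2 : 0 <= P2 by exact: pow2_ge_0.
have HK : 0 < I / (2 * (P2 + 1)) by apply: Rdiv_lt_0_compat; lra.
have := small _ HK.
have -> : I / (2 * (P2 + 1)) * P2 = I / 2 * (P2 / (P2 + 1)) by field; lra.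
have : P2 / (P2 + 1) <= 1.
  by apply/Rle_div_l; lra.
nra.
Qed.

(** * Cauchy's formula for the derivative *)

Lemma derivable_pt_lim_eps (f : R -> R) (l : R) :
  derivable_pt_lim f 0 l -> forall eps, 0 < eps -> exists delta, 0 < delta /\
    forall h, Rabs h < delta -> Rabs (f h - f 0 - l * h) <= eps * Rabs h.
Proof.
move=> H eps Heps; have [d Hd] := H eps Heps.
exists d; split; first exact: cond_pos.
move=> h Hh; case: (Req_dec h 0) => [->|H0].
  by rewrite Rmult_0_r !Rminus_0_r Rminus_diag Rabs_R0; lra.
have := Hd h H0 Hh; rewrite Rplus_0_l => {}Hd.
have -> : f h - f 0 - l * h = ((f h - f 0) / h - l) * h by field.
rewrite Rabs_mult; apply: Rmult_le_compat_r; [exact: Rabs_pos | lra].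
Qed.

Definition unit_circle (t : R) : C := (cos t, sin t).

Definition cexp (w : C) : C := (RtoC (exp (Re w)) * unit_circle (Im w))%C.

Lemma Cmod_unit_circle (t : R) : Cmod (unit_circle t) = 1.
Proof.
transitivity (sqrt 1); last exact: sqrt_1.
rewrite /Cmod /unit_circle /=; congr sqrt.
have := sin2_cos2 t; rewrite /Rsqr; lra.
Qed.

Lemma cexp_plus (z w : C) : cexp (z + w)%C = (cexp z * cexp w)%C.
Proof.
case: z => x y; case: w => u v.
rewrite /cexp /unit_circle /= cos_plus sin_plus exp_plus /RtoC /Cmult /=.
by congr pair; ring.
Qed.

(** With first-order errors at most [e |x|] for [exp], [sin] and [cos] near 0, the
    total error is at most [8 e |w|]; the cross term [(exp x - 1) y] is what
    requires [|w| < e / 2]. *)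
Lemma is_Cderive_cexp_0 : is_Cderive cexp (RtoC 0) (RtoC 1).
Proof.
apply/is_Cderive_eps => eps Heps.
set e := Rmin 1 (eps / 8).
have He : 0 < e by apply: Rmin_glb_lt; lra.
have He1 : e <= 1 := Rmin_l _ _.
have He8 : 8 * e <= eps by have := Rmin_r 1 (eps / 8); rewrite -/e; lra.
have [d1 [Hd1 H1]] := derivable_pt_lim_eps exp 1 derivable_pt_lim_exp_0 e He.
have [d2 [Hd2 H2]] := derivable_pt_lim_eps sin 1 derivable_pt_lim_sin_0 e He.
have [d3 [Hd3 H3]] := derivable_pt_lim_eps cos 0 derivable_pt_lim_cos_0 e He.
exists (Rmin (e / 2) (Rmin d1 (Rmin d2 d3))); split.
  by repeat apply: Rmin_glb_lt; lra.
case=> x y.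
have -> : ((x, y) - RtoC 0)%C = (x, y) by rewrite /Cminus /Cplus /=; congr pair; ring.
move=> Hw.
have Hwe := Rlt_le_trans _ _ _ Hw (Rmin_l _ _).
have Hw' := Rlt_le_trans _ _ _ Hw (Rmin_r _ _).
have Hw1 := Rlt_le_trans _ _ _ Hw' (Rmin_l _ _).
have {}Hw' := Rlt_le_trans _ _ _ Hw' (Rmin_r _ _).
have Hw2 := Rlt_le_trans _ _ _ Hw' (Rmin_l _ _).
have Hw3 := Rlt_le_trans _ _ _ Hw' (Rmin_r _ _).
have Hx : Rabs x <= Cmod (x, y) := Rle_trans _ _ _ (Rmax_l _ _) (Rmax_Cmod (x, y)).
have Hy : Rabs y <= Cmod (x, y) := Rle_trans _ _ _ (Rmax_r _ _) (Rmax_Cmod (x, y)).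
have {}H1 := H1 x (Rle_lt_trans _ _ _ Hx Hw1).
have {}H2 := H2 y (Rle_lt_trans _ _ _ Hy Hw2).
have {}H3 := H3 y (Rle_lt_trans _ _ _ Hy Hw3).
set m := Cmod (x, y) in Hwe Hx Hy *.
rewrite exp_0 in H1; rewrite sin_0 in H2; rewrite cos_0 in H3.
have Ax := Rabs_pos x; have Ay := Rabs_pos y.
have Hexp : Rabs (exp x - 1) <= 2 * Rabs x.
  have := Rabs_triang (exp x - 1 - 1 * x) (1 * x).
  have -> : exp x - 1 - 1 * x + 1 * x = exp x - 1 by ring.
  rewrite (Rmult_1_l x) in H1 * => H; nra.
have Hexp3 : Rabs (exp x) <= 3.
  have := Rabs_triang (exp x - 1) 1.
  have -> : exp x - 1 + 1 = exp x by ring.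
  rewrite Rabs_R1; lra.
have -> : (cexp (x, y) - cexp (RtoC 0) - RtoC 1 * (x, y))%C =
  ((exp x - 1 - 1 * x) + exp x * (cos y - 1 - 0 * y),
    exp x * (sin y - 0 - 1 * y) + (exp x - 1) * y).
  rewrite /cexp /unit_circle /= exp_0 cos_0 sin_0.
  by rewrite /Cminus /Cplus /Copp /Cmult /RtoC /=; congr pair; ring.
apply: Rle_trans (Cmod_le_abs _ _) _.
have B1 := Rabs_triang (exp x - 1 - 1 * x) (exp x * (cos y - 1 - 0 * y)).
have B2 := Rabs_triang (exp x * (sin y - 0 - 1 * y)) ((exp x - 1) * y).
rewrite !Rabs_mult in B1 B2.
have B3 : Rabs (exp x) * Rabs (cos y - 1 - 0 * y) <= 3 * (e * Rabs y).
  by apply: Rmult_le_compat => //; exact: Rabs_pos.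
have B4 : Rabs (exp x) * Rabs (sin y - 0 - 1 * y) <= 3 * (e * Rabs y).
  by apply: Rmult_le_compat => //; exact: Rabs_pos.
have B5 : Rabs (exp x - 1) * Rabs y <= e * Rabs y.
  by apply: Rmult_le_compat_r => //; lra.
have B6 : e * Rabs y <= e * m by apply: Rmult_le_compat_l => //; lra.
have B7 : e * Rabs x <= e * m by apply: Rmult_le_compat_l => //; lra.
have : 8 * e * m <= eps * m by apply: Rmult_le_compat_r => //; lra.
lra.
Qed.

Lemma is_Cderive_cexp (z : C) : is_Cderive cexp z (cexp z).
Proof.
have Hz : is_Cderive (fun w => w - z)%C z (RtoC 1).
  apply: is_Cderive_val (is_Cderive_minus _ _ _ _ _ (is_Cderive_id z) (is_Cderive_const z z)).
  ring.
have H0 : is_Cderive cexp (z - z)%C (RtoC 1).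
  by have -> : (z - z = RtoC 0)%C by [ring]; exact: is_Cderive_cexp_0.
have H := is_Cderive_scal _ _ _ (cexp z) (is_Cderive_comp cexp (fun w => w - z)%C z _ _ H0 Hz).
apply: (is_Cderive_ext_ball _ _ _ _ 1 Rlt_0_1 _ (is_Cderive_val _ _ _ _ _ H)); last by ring.
by move=> w _; rewrite -cexp_plus; congr cexp; ring.
Qed.

Lemma Cmod_cexp (x y : R) : Cmod (cexp (x, y)) = exp x.
Proof.
rewrite /cexp Cmod_mult Cmod_unit_circle Cmod_R Rmult_1_r /=.
by apply: Rabs_pos_eq; apply: Rlt_le; exact: exp_pos.
Qed.

(** In the coordinate [z = cexp w] the annulus becomes a rectangle of height
    [2 * PI]; by periodicity the integrals of [f o cexp] along its horizontal
    sides agree, so Goursat's theorem equates those along the vertical sides. *)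
Lemma circle_mean_constant (f : C -> C) (R0 r1 r2 : R) :
  (forall z, 0 < Cmod z < R0 -> ex_Cderive f z) ->
  0 < r1 -> r1 <= r2 -> r2 < R0 ->
  RIntC (fun t => f (RtoC r1 * unit_circle t)%C) 0 (2 * PI) =
  RIntC (fun t => f (RtoC r2 * unit_circle t)%C) 0 (2 * PI).
Proof.
move=> Hf H1 H12 H2.
have HPI := PI_RGT_0.
have Hln : ln r1 <= ln r2.
  by case: H12 => [H|->]; [apply: Rlt_le; exact: ln_increasing | exact: Rle_refl].
have : rect_int (fun w => f (cexp w)) (ln r1) (ln r2) 0 (2 * PI) = RtoC 0.
  apply: goursat_rectangle => //; first lra.
  move=> x y Hx Hy.
  have [|l Hl] := Hf (cexp (x, y)).
    rewrite Cmod_cexp; split; first exact: exp_pos.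
    apply: Rle_lt_trans H2; rewrite -(exp_ln r2); last lra.
    by case: (proj2 Hx) => [H|->]; [apply: Rlt_le; exact: exp_increasing | exact: Rle_refl].
  exists (l * cexp (x, y))%C; exact: is_Cderive_comp Hl (is_Cderive_cexp _).
rewrite /rect_int.
have Ecirc r : 0 < r -> RIntC (fun y => f (cexp (ln r, y))) 0 (2 * PI) =
    RIntC (fun t => f (RtoC r * unit_circle t)%C) 0 (2 * PI).
  by move=> Hr; apply: RInt_ext => t _; rewrite /cexp /= exp_ln.
have -> : RIntC (fun x => f (cexp (x, 2 * PI))) (ln r1) (ln r2) =
    RIntC (fun x => f (cexp (x, 0))) (ln r1) (ln r2).
  apply: RInt_ext => x _; congr f; rewrite /cexp /unit_circle /=.
  by rewrite cos_2PI sin_2PI cos_0 sin_0.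
rewrite !Ecirc; try lra.
set I1 : C := RIntC (fun t => f (RtoC r1 * unit_circle t)%C) 0 (2 * PI).
set I2 : C := RIntC (fun t => f (RtoC r2 * unit_circle t)%C) 0 (2 * PI).
set J : C := RIntC (fun x => f (cexp (x, 0))) (ln r1) (ln r2).
have Hi : Ci <> RtoC 0 by apply/Cmod_gt_0; rewrite Cmod_Ci; lra.
move=> E.
change (I1 = I2).
have -> : I2 = (I1 + / Ci * (J - J + Ci * (I2 - I1)))%C by field.
rewrite E; ring.
Qed.

Lemma ex_RIntC_circle (f : C -> C) (r a b : R) :
  (forall t, ex_Cderive f (RtoC r * unit_circle t)%C) ->
  ex_RIntC (fun t => f (RtoC r * unit_circle t)%C) a b.
Proof.
move=> Hf; apply: (ex_RInt_continuous (V := C_R_CompleteNormedModule)) => t _.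
have Hp : is_path_derive (fun s => RtoC r * unit_circle s)%C t
    (RtoC r * (cexp (0, t) * Ci))%C.
  apply: (is_path_derive_comp (fun w => RtoC r * w)%C unit_circle t (RtoC r)).
    by apply: is_Cderive_val (is_Cderive_scal _ _ _ _ (is_Cderive_id _)); ring.
  apply: is_derive_ext (is_path_derive_comp cexp (fun s => (0, s) : C) t _ _
    (is_Cderive_cexp _) (is_path_derive_vertical 0 t)) => s.
  by rewrite /cexp /= exp_0 Cmult_1_l.
exact: continuous_path_comp (Hf t) Hp.
Qed.

Lemma circle_point_mod (r t : R) : 0 < r -> Cmod (RtoC r * unit_circle t)%C = r.
Proof. by move=> Hr; rewrite Cmod_mult Cmod_unit_circle Cmod_R Rabs_pos_eq; lra. Qed.

Lemma is_Cderive_translate (f : C -> C) (a z l : C) :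
  is_Cderive f (a + z)%C l -> is_Cderive (fun w => f (a + w)%C) z l.
Proof.
move=> Hf; apply: is_Cderive_val (is_Cderive_comp f (fun w => a + w)%C z _ _ Hf
  (is_Cderive_plus _ _ _ _ _ (is_Cderive_const a z) (is_Cderive_id z))).
ring.
Qed.

Lemma ex_Cderive_slope (f : C -> C) (z : C) :
  z <> RtoC 0 -> ex_Cderive f z -> ex_Cderive (fun w => (f w - f (RtoC 0)) / w)%C z.
Proof.
move=> Hz [l Hl].
exists (((l - RtoC 0) * z - (f z - f (RtoC 0)) * RtoC 1) / (z * z))%C.
apply: (is_Cderive_div (fun w => f w - f (RtoC 0))%C (fun w => w)) => //.
- exact: is_Cderive_minus Hl (is_Cderive_const _ _).
- exact: is_Cderive_id.
Qed.

Lemma RIntC_const (a b : R) (c : C) : RIntC (fun _ => c) a b = (RtoC (b - a) * c)%C.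
Proof. by rewrite -scal_R_Cmult; exact: (RInt_const (V := C_R_CompleteNormedModule)). Qed.

(** The right-hand side is the limit of circle means of the difference quotient
    as the radius shrinks; these means are all equal.  No removable singularity
    is involved, as the quotient is only used away from [a]. *)
Lemma cauchy_derivative (f : C -> C) (a : C) (R0 r : R) :
  (forall z, Cmod (z - a) < R0 -> ex_Cderive f z) -> 0 < r < R0 ->
  RIntC (fun t => (f (a + RtoC r * unit_circle t) - f a) / (RtoC r * unit_circle t))%C 0 (2 * PI)
    = (RtoC (2 * PI) * C_derive f a)%C.
Proof.
move=> Hf Hr.
have HPI := PI_RGT_0.
pose s := fun z : C => ((f (a + z) - f (a + RtoC 0)) / z)%C.
have Ea : (a + RtoC 0 = a)%C by ring.
have Hs z : 0 < Cmod z < R0 -> ex_Cderive s z.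
  move=> Hz; apply: (ex_Cderive_slope (fun w => f (a + w)%C)).
    by apply/Cmod_gt_0; lra.
  have [|l Hl] := Hf (a + z)%C.
    by have -> : (a + z - a = z)%C by [ring]; lra.
  by exists l; exact: is_Cderive_translate.
have Ds := proj1 (is_Cderive_eps f a _) (C_derive_correct f a (RtoC 0) _).
have close eps : 0 < eps ->
    Cmod (RIntC (fun t => s (RtoC r * unit_circle t)%C) 0 (2 * PI)
      - RtoC (2 * PI) * C_derive f a)%C <= 2 * PI * eps.
  move=> Heps.
  have [|d [Hd H]] := Ds _ eps Heps.
    by apply: Hf; have -> : (a - a = RtoC 0)%C by [ring]; rewrite Cmod_0; lra.
  set q := Rmin r (d / 2).
  have Hq : 0 < q by apply: Rmin_glb_lt; lra.
  have Hqr : q <= r := Rmin_l _ _.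
  have Hqd : q <= d / 2 := Rmin_r _ _.
  rewrite -(circle_mean_constant s R0 q r) //; try lra.
  have HI : ex_RIntC (fun t => s (RtoC q * unit_circle t)%C) 0 (2 * PI).
    by apply: ex_RIntC_circle => t; apply: Hs; rewrite circle_point_mod; lra.
  have Hc : ex_RIntC (fun _ => C_derive f a) 0 (2 * PI) by exact: ex_RInt_const.
  have -> : (RtoC (2 * PI) * C_derive f a)%C = RIntC (fun _ => C_derive f a) 0 (2 * PI).
    by rewrite RIntC_const Rminus_0_r.
  rewrite -RIntC_minus //.
  have -> : 2 * PI * eps = (2 * PI - 0) * eps by ring.
  apply: Cmod_RIntC_le; first lra.
    exact: (ex_RInt_minus (V := C_R_NormedModule)).
  move=> t _; set z := (RtoC q * unit_circle t)%C.
  have Hz : Cmod z = q by exact: circle_point_mod.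
  have Hz0 : z <> RtoC 0 by apply/Cmod_gt_0; lra.
  have -> : (s z - C_derive f a = (f (a + z) - f a - C_derive f a * (a + z - a)) / z)%C.
    by rewrite /s Ea; field.
  rewrite Cmod_div //; apply/Rle_div_l; first lra.
  have := H (a + z)%C; have -> : (a + z - a = z)%C by ring.
  by apply; lra.
have -> : RIntC (fun t => (f (a + RtoC r * unit_circle t) - f a) / (RtoC r * unit_circle t))%C
    0 (2 * PI) = RIntC (fun t => s (RtoC r * unit_circle t)%C) 0 (2 * PI).
  by apply: RInt_ext => t _; rewrite /s Ea.
set I : C := RIntC _ _ _ in close *; set L := (_ * _)%C in close *.
have H0 : Cmod (I - L) = 0.
  apply: Rle_antisym (Cmod_ge_0 _); apply: Rnot_lt_le => Hpos.
  have := close (Cmod (I - L) / (4 * PI)).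
  have -> : 2 * PI * (Cmod (I - L) / (4 * PI)) = Cmod (I - L) / 2 by field; lra.
  move=> H; have {}H := H (Rdiv_lt_0_compat _ _ Hpos (Rmult_lt_0_compat 4 PI ltac:(lra) HPI)).
  lra.
change (I = L).
have -> : I = (I - L + L)%C by ring.
rewrite (Cmod_eq_0 _ H0); ring.
Qed.

Lemma cauchy_estimate (f : C -> C) (a : C) (R0 r M : R) :
  (forall z, Cmod (z - a) < R0 -> ex_Cderive f z) -> 0 < r < R0 ->
  (forall z, Cmod (z - a) = r -> Cmod (f z - f a) <= M) ->
  Cmod (C_derive f a) <= M / r.
Proof.
move=> Hf Hr HM; have HPI := PI_RGT_0.
have E := cauchy_derivative f a R0 r Hf Hr.
have : Cmod (RtoC (2 * PI) * C_derive f a)%C <= (2 * PI - 0) * (M / r).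
  rewrite -E; apply: Cmod_RIntC_le; first lra.
    apply: (ex_RIntC_circle (fun w => (f (a + w) - f a) / w)%C) => t.
    have Hz : Cmod (RtoC r * unit_circle t) = r by apply: circle_point_mod; lra.
    set z := (RtoC r * unit_circle t)%C in Hz *.
    have := ex_Cderive_slope (fun w => f (a + w)%C) z.
    have -> : (a + RtoC 0 = a)%C by ring.
    apply; first by apply/Cmod_gt_0; lra.
    have [|l Hl] := Hf (a + z)%C.
      by have -> : (a + z - a = z)%C by [ring]; lra.
    by exists l; exact: is_Cderive_translate.
  move=> t _.
  have Hz : Cmod (RtoC r * unit_circle t) = r by apply: circle_point_mod; lra.
  set z := (RtoC r * unit_circle t)%C in Hz *.
  rewrite Cmod_div; last by apply/Cmod_gt_0; lra.
  rewrite Hz; apply: Rmult_le_compat_r; first by apply: Rlt_le; apply: Rinv_0_lt_compat; lra.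
  by apply: HM; have -> : (a + z - a = z)%C by [ring].
rewrite Cmod_mult Cmod_R (Rabs_pos_eq (2 * PI)); last lra.
rewrite Rminus_0_r.
move=> H; apply: Rmult_le_reg_l H; lra.
Qed.

Definition holo_ball (f : C -> C) (a : C) (r : R) : Prop :=
  forall z, Cmod (z - a) < r -> ex_Cderive f z.

Lemma Cmod_dist_triangle (x y z : C) : Cmod (x - z) <= Cmod (x - y) + Cmod (y - z).
Proof. by have -> : (x - z = (x - y) + (y - z))%C by [ring]; exact: Cmod_triangle. Qed.

Lemma mean_value_ball (f : C -> C) (a : C) (r K : R) :
  holo_ball f a r -> (forall z, Cmod (z - a) < r -> Cmod (C_derive f z) <= K) ->
  forall z w, Cmod (z - a) < r -> Cmod (w - a) < r ->
  Cmod (f w - f z) <= K * Cmod (w - z).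
Proof.
move=> Hf HK z w Hz Hw; apply: mean_value_segment => t Ht.
have H : Cmod (z + RtoC t * (w - z) - a) < r.
  have -> : (z + RtoC t * (w - z) - a = RtoC (1 - t) * (z - a) + RtoC t * (w - a))%C.
    by rewrite RtoC_minus; ring.
  apply: Rle_lt_trans (Cmod_triangle _ _) _.
  rewrite !Cmod_mult !Cmod_R !Rabs_pos_eq; try lra.
  case: (Rle_lt_dec (1 / 2) t) => H; nra.
by split; [exact: Hf | exact: HK].
Qed.

Lemma ex_Cderive_continuous_at (f : C -> C) (a : C) : ex_Cderive f a ->
  exists d, 0 < d /\ forall z, Cmod (z - a) < d -> Cmod (f z - f a) <= 1.
Proof.
move=> [l /is_Cderive_eps H]; have [d [Hd {}H]] := H 1 Rlt_0_1.
have Hl := Cmod_ge_0 l.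
exists (Rmin d (/ (Cmod l + 1))); split.
  by apply: Rmin_glb_lt => //; apply: Rinv_0_lt_compat; lra.
move=> z Hz.
have Hz1 := Rlt_le_trans _ _ _ Hz (Rmin_l _ _).
have Hz2 := Rlt_le_trans _ _ _ Hz (Rmin_r _ _).
have := H z Hz1.
have := Cmod_triangle (f z - f a - l * (z - a)) (l * (z - a)).
have -> : (f z - f a - l * (z - a) + l * (z - a) = f z - f a)%C by ring.
rewrite Cmod_mult.
have : Cmod (z - a) * (Cmod l + 1) <= / (Cmod l + 1) * (Cmod l + 1).
  by apply: Rmult_le_compat_r; lra.
rewrite Rinv_l; lra.
Qed.

(** Cauchy's estimate is used twice: for [f], which is bounded near [a], to bound
    [f'], so that [f] is Lipschitz; then for [u |-> f (w + u) - f (z + u)], which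
    is therefore of size [|w - z|], to bound its derivative [f' w - f' z]. *)
Lemma C_derive_locally_lipschitz (f : C -> C) (a : C) (r : R) :
  0 < r -> holo_ball f a r ->
  exists d L, 0 < d /\ 8 * d <= r /\ 0 <= L /\
    forall z w, Cmod (z - a) < 2 * d -> Cmod (w - a) < 2 * d ->
    Cmod (C_derive f w - C_derive f z) <= L * Cmod (w - z).
Proof.
move=> Hr Hf.
have [|d0 [Hd0 Hb]] := ex_Cderive_continuous_at f a.
  by apply: Hf; have -> : (a - a = RtoC 0)%C by [ring]; rewrite Cmod_0.
set d := Rmin d0 r / 8.
have Hd : 0 < d.
  by rewrite /d; have := Rmin_glb_lt _ _ _ Hd0 Hr; lra.
have Hdr : 8 * d <= r by have := Rmin_r d0 r; rewrite /d; lra.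
have Hdd : 8 * d <= d0 by have := Rmin_l d0 r; rewrite /d; lra.
have Hder z : Cmod (z - a) < 4 * d -> Cmod (C_derive f z) <= 2 / d.
  move=> Hz; apply: (cauchy_estimate f z (4 * d)); last 1 first.
  - move=> w Hw.
    have H1 : Cmod (f w - f a) <= 1.
      by apply: Hb; have := Cmod_dist_triangle w z a; lra.
    have H2 : Cmod (f z - f a) <= 1 by apply: Hb; lra.
    have := Cmod_dist_triangle (f w) (f a) (f z).
    rewrite (Cmod_sub_sym (f a)); lra.
  - by move=> w Hw; apply: Hf; have := Cmod_dist_triangle w z a; lra.
  - lra.
exists d, (4 / d / d); split => //; split => //.
have HL : 0 < 2 / d by apply: Rdiv_lt_0_compat; lra.
split.
  by apply: Rlt_le; do 2 (apply: Rdiv_lt_0_compat => //); lra.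
move=> z w Hz Hw.
pose F := fun u => (f (w + u) - f (z + u))%C.
have HF u : Cmod u < 2 * d -> is_Cderive F u (C_derive f (w + u) - C_derive f (z + u))%C.
  move=> Hu; apply: is_Cderive_minus; apply: is_Cderive_translate;
    apply: (C_derive_correct _ _ (RtoC 0)); apply: Hf.
  - have -> : (w + u - a = (w - a) + u)%C by ring.
    by apply: Rle_lt_trans (Cmod_triangle _ _) _; lra.
  - have -> : (z + u - a = (z - a) + u)%C by ring.
    by apply: Rle_lt_trans (Cmod_triangle _ _) _; lra.
have E : C_derive F (RtoC 0) = (C_derive f w - C_derive f z)%C.
  apply: is_C_derive_unique.
  have := HF (RtoC 0); rewrite !Cplus_0_r Cmod_0; apply; lra.
rewrite -E.
have -> : 4 / d / d * Cmod (w - z) = (2 * (2 / d * Cmod (w - z))) / d by field; lra.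
apply: (cauchy_estimate F (RtoC 0) (2 * d)); last 1 first.
- move=> u; have -> : (u - RtoC 0 = u)%C by [ring]; move=> Hu.
  apply: Rle_trans (Cmod_sub_le _ _) _.
  have M x y : Cmod (x - a) < 4 * d -> Cmod (y - a) < 4 * d ->
      Cmod (f y - f x) <= 2 / d * Cmod (y - x).
    apply: (mean_value_ball f a (4 * d)) => // v Hv; apply: Hf; lra.
  have M1 := M (z + RtoC 0)%C (w + RtoC 0)%C.
  have M2 := M (z + u)%C (w + u)%C.
  rewrite !Cplus_0_r in M1.
  have Ew : (w + u - (z + u) = w - z)%C by ring.
  rewrite /F !Cplus_0_r; rewrite Ew in M2.
  have : Cmod (f w - f z) <= 2 / d * Cmod (w - z) by apply: M1; lra.
  have : Cmod (f (w + u)%C - f (z + u)%C) <= 2 / d * Cmod (w - z).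
    apply: M2.
    - have -> : (z + u - a = (z - a) + u)%C by ring.
      by apply: Rle_lt_trans (Cmod_triangle _ _) _; lra.
    - have -> : (w + u - a = (w - a) + u)%C by ring.
      by apply: Rle_lt_trans (Cmod_triangle _ _) _; lra.
  lra.
- move=> u; have -> : (u - RtoC 0 = u)%C by [ring]; move=> Hu.
  by eexists; exact: HF.
- lra.
Qed.

(** The real and imaginary parts are integrated separately, since the integral is
    that of a real vector space. *)
Lemma RIntC_scal (f : R -> C) (a b : R) (c : C) : ex_RIntC f a b ->
  @is_RInt C_R_NormedModule (fun t => c * f t)%C a b (c * RIntC f a b)%C.
Proof.
move=> /(RInt_correct (V := C_R_CompleteNormedModule)) H.
set I : C := RIntC f a b; change (is_RInt (V := C_R_NormedModule) f a b I) in H.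
have H1 : is_RInt (fun t => fst (f t)) a b (fst I) := is_RInt_fct_extend_fst _ _ _ _ H.
have H2 : is_RInt (fun t => snd (f t)) a b (snd I) := is_RInt_fct_extend_snd _ _ _ _ H.
apply: (is_RInt_fct_extend_pair (U := R_NormedModule) (V := R_NormedModule)).
- exact: is_RInt_minus (is_RInt_scal _ _ _ (fst c) _ H1) (is_RInt_scal _ _ _ (snd c) _ H2).
- exact: is_RInt_plus (is_RInt_scal _ _ _ (fst c) _ H2) (is_RInt_scal _ _ _ (snd c) _ H1).
Qed.

Lemma continuous_lipschitz (h : R -> C) (M t : R) :
  (forall s, Cmod (h s - h t) <= M * Rabs (s - t)) ->
  @continuous R_UniformSpace C_R_NormedModule h t.
Proof.
move=> H; apply/filterlim_locally => eps.
have He := cond_pos eps; have HM := Rabs_pos M.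
have Hd : 0 < eps / (Rabs M + 1) by apply: Rdiv_lt_0_compat; lra.
exists (mkposreal _ Hd) => s Hs.
apply: C_NormedModule_mixin_compat1.
apply: Rle_lt_trans (H s) _.
have {}Hs : Rabs (s - t) < eps / (Rabs M + 1) by exact: Hs.
have : Rabs (s - t) * (Rabs M + 1) < eps / (Rabs M + 1) * (Rabs M + 1).
  by apply: Rmult_lt_compat_r; lra.
have -> : eps / (Rabs M + 1) * (Rabs M + 1) = eps by field; lra.
have := Rle_abs M; have := Rabs_pos (s - t); nra.
Qed.

Lemma unit_circle_lipschitz (s t : R) :
  Cmod (unit_circle s - unit_circle t) <= Rabs (s - t).
Proof.
have E x : unit_circle x = cexp (0, x) by rewrite /cexp /= exp_0 Cmult_1_l.
have Est u v : ((0, u) - (0, v))%C = (RtoC (u - v) * Ci)%C.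
  by rewrite /Cminus /Cplus /Copp /Cmult /RtoC /Ci /=; congr pair; ring.
rewrite !E; have := mean_value_segment cexp (0, t) (0, s) 1.
rewrite Est Cmod_mult Cmod_Ci Cmod_R Rmult_1_l Rmult_1_r; apply => u _; split.
  by eexists; exact: is_Cderive_cexp.
rewrite (is_C_derive_unique _ _ _ (is_Cderive_cexp _)).
have -> : ((0, t) + RtoC u * (RtoC (s - t) * Ci))%C = (0, t + u * (s - t)).
  by rewrite /Cplus /Cmult /RtoC /Ci /=; congr pair; ring.
by rewrite Cmod_cexp exp_0; exact: Rle_refl.
Qed.

(** The candidate [c] for the second derivative is the circle mean of
    [(f' (a + p) - f' a) / p].  The formula for the first derivative, applied to
    [u |-> f (a + eta + u) - f (a + u)], writes [f' (a + eta) - f' a - c * eta] as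
    the mean of an integrand which the Lipschitz bound on [f'] makes [O(|eta|^2)]
    uniformly on the circle. *)
Theorem ex_Cderive_C_derive (f : C -> C) (a : C) (r : R) :
  0 < r -> holo_ball f a r -> ex_Cderive (C_derive f) a.
Proof.
move=> Hr Hf; have HPI := PI_RGT_0.
have [d [L [Hd [Hdr [HL Hlip]]]]] := C_derive_locally_lipschitz f a r Hr Hf.
have Hder z : Cmod (z - a) < 8 * d -> is_Cderive f z (C_derive f z).
  by move=> Hz; apply: (C_derive_correct _ _ (RtoC 0)); apply: Hf; lra.
pose p t := (RtoC d * unit_circle t)%C.
have Hp t : Cmod (p t) = d by exact: circle_point_mod.
have Hp0 t : p t <> RtoC 0 by apply/Cmod_gt_0; rewrite Hp.
pose q t := ((C_derive f (a + p t) - C_derive f a) / p t)%C.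
have Ep u : (a + u - a = u)%C by ring.
have Eaa : Cmod (a - a) = 0 by have -> : (a - a = RtoC 0)%C by [ring]; rewrite Cmod_0.
have Hq : ex_RIntC q 0 (2 * PI).
  apply: (ex_RInt_continuous (V := C_R_CompleteNormedModule)) => t _.
  apply: (continuous_lipschitz q (2 * L)) => s.
  have Hps : Cmod (p s - p t) <= d * Rabs (s - t).
    have -> : (p s - p t = RtoC d * (unit_circle s - unit_circle t))%C by rewrite /p; ring.
    rewrite Cmod_mult Cmod_R Rabs_pos_eq; last lra.
    by apply: Rmult_le_compat_l; [lra | exact: unit_circle_lipschitz].
  have -> : (q s - q t = (C_derive f (a + p s) - C_derive f (a + p t)) / p s +
      (C_derive f (a + p t) - C_derive f a) * (p t - p s) / (p s * p t))%C.
    by rewrite /q; field; split.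
  apply: Rle_trans (Cmod_triangle _ _) _.
  rewrite (Cmod_div _ (p s)) // (Cmod_div _ (p s * p t)%C); last exact: Cmult_neq_0.
  rewrite (Cmod_mult (p s)) (Cmod_mult _ (p t - p s)) !Hp (Cmod_sub_sym (p t)).
  have B1 : Cmod (C_derive f (a + p s) - C_derive f (a + p t)) <= L * Cmod (p s - p t).
    have := Hlip (a + p t)%C (a + p s)%C; rewrite !Ep !Hp.
    have -> : (a + p s - (a + p t) = p s - p t)%C by ring.
    by apply; lra.
  have B2 : Cmod (C_derive f (a + p t) - C_derive f a) <= L * d.
    have := Hlip a (a + p t)%C; rewrite Ep Hp Eaa; apply; lra.
  have C1 : Cmod (C_derive f (a + p s) - C_derive f (a + p t)) / d <= L * Rabs (s - t).
    apply/Rle_div_l => //; apply: Rle_trans B1 _.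
    by have := Rmult_le_compat_l _ _ _ HL Hps; lra.
  have C2 : Cmod (C_derive f (a + p t) - C_derive f a) * Cmod (p s - p t) / (d * d)
      <= L * Rabs (s - t).
    apply/Rle_div_l; first by apply: Rmult_lt_0_compat.
    apply: Rle_trans (Rmult_le_compat _ _ _ _ (Cmod_ge_0 _) (Cmod_ge_0 _) B2 Hps) _.
    lra.
  lra.
pose c := (/ RtoC (2 * PI) * RIntC q 0 (2 * PI))%C.
have H2PI : RtoC (2 * PI) <> RtoC 0 by apply/Cmod_gt_0; rewrite Cmod_R Rabs_pos_eq; lra.
have key eta : Cmod eta < d ->
    Cmod (C_derive f (a + eta) - C_derive f a - c * eta) <= 2 * L / d * Cmod eta ^ 2.
  move=> Heta; have Heta0 := Cmod_ge_0 eta.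
  pose F u := (f ((a + eta) + u) - f (a + u))%C.
  have HF u : Cmod u < 2 * d ->
      is_Cderive F u (C_derive f ((a + eta) + u) - C_derive f (a + u))%C.
    move=> Hu; apply: is_Cderive_minus; apply: is_Cderive_translate; apply: Hder.
    - have -> : (a + eta + u - a = eta + u)%C by ring.
      by apply: Rle_lt_trans (Cmod_triangle _ _) _; lra.
    - by rewrite Ep; lra.
  have EF : C_derive F (RtoC 0) = (C_derive f (a + eta) - C_derive f a)%C.
    apply: is_C_derive_unique.
    have := HF (RtoC 0); rewrite !Cplus_0_r Cmod_0; apply; lra.
  have HFz z : Cmod (z - RtoC 0) < 2 * d -> ex_Cderive F z.
    have -> : (z - RtoC 0 = z)%C by ring.
    by move=> Hz; eexists; exact: HF.
  have EG := cauchy_derivative F (RtoC 0) (2 * d) d HFz.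
  pose G t := ((F (p t) - F (RtoC 0)) / p t)%C.
  have {}EG : RIntC G 0 (2 * PI) = (RtoC (2 * PI) * (C_derive f (a + eta) - C_derive f a))%C.
    rewrite -EF -EG; last lra.
    by apply: RInt_ext => t _; rewrite Cplus_0_l.
  have HG : ex_RIntC G 0 (2 * PI).
    apply: (ex_RIntC_circle (fun w => (F w - F (RtoC 0)) / w)%C) => t.
    apply: ex_Cderive_slope; first exact: Hp0.
    by eexists; apply: HF; rewrite (Hp t); lra.
  have Heq := RIntC_scal q 0 (2 * PI) eta Hq.
  have bound t : Cmod (G t - eta * q t) <= 2 * L * Cmod eta ^ 2 / d.
    have T u : Cmod u <= d ->
        Cmod (F u - eta * C_derive f (a + u)) <= L * Cmod eta * Cmod eta.
      move=> Hu.
      pose g w := (f w - C_derive f (a + u) * w)%C.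
      have := mean_value_segment g (a + u)%C (a + u + eta)%C (L * Cmod eta).
      have -> : (a + u + eta - (a + u) = eta)%C by ring.
      have -> : (g (a + u + eta) - g (a + u) = F u - eta * C_derive f (a + u))%C.
        rewrite /g /F; have -> : (a + u + eta = a + eta + u)%C by ring.
        ring.
      apply=> x Hx; set w := (a + u + RtoC x * eta)%C.
      have Hxe : Cmod (RtoC x * eta) <= Cmod eta.
        rewrite Cmod_mult Cmod_R Rabs_pos_eq; last lra.
        by have := Rmult_le_compat_r _ _ _ Heta0 (proj2 Hx); lra.
      have Hw : Cmod (w - a) < 2 * d.
        have -> : (w - a = u + RtoC x * eta)%C by rewrite /w; ring.
        by apply: Rle_lt_trans (Cmod_triangle _ _) _; lra.
      have Dg : is_Cderive g w (C_derive f w - C_derive f (a + u))%C.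
        apply: is_Cderive_minus; first by apply: Hder; lra.
        by apply: is_Cderive_val (is_Cderive_scal _ _ _ _ (is_Cderive_id w)); ring.
      split; first by eexists; exact: Dg.
      rewrite (is_C_derive_unique _ _ _ Dg).
      apply: Rle_trans (Hlip _ _ _ Hw) _; first by rewrite Ep; lra.
      have -> : (w - (a + u) = RtoC x * eta)%C by rewrite /w; ring.
      exact: Rmult_le_compat_l.
    have -> : (G t - eta * q t = ((F (p t) - eta * C_derive f (a + p t)) -
       (F (RtoC 0) - eta * C_derive f (a + RtoC 0))) / p t)%C.
      by rewrite /G /q Cplus_0_r; field.
    rewrite Cmod_div // (Hp t); apply: Rmult_le_compat_r.
      by apply: Rlt_le; exact: Rinv_0_lt_compat.
    apply: Rle_trans (Cmod_sub_le _ _) _.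
    have := T (p t); have := T (RtoC 0); rewrite (Hp t) Cmod_0 /=; lra.
  have : Cmod (RtoC (2 * PI) * (C_derive f (a + eta) - C_derive f a - c * eta))%C
      <= (2 * PI - 0) * (2 * L * Cmod eta ^ 2 / d).
    have -> : (RtoC (2 * PI) * (C_derive f (a + eta) - C_derive f a - c * eta))%C =
       RIntC (fun t => G t - eta * q t)%C 0 (2 * PI).
      rewrite RIntC_minus //; last by eexists; exact: Heq.
      rewrite (is_RInt_unique (V := C_R_CompleteNormedModule) _ _ _ _ Heq) EG /c.
      by field.
    apply: Cmod_RIntC_le => //; first lra.
    apply: (ex_RInt_minus (V := C_R_NormedModule)) => //.
    by eexists; exact: Heq.
  rewrite Cmod_mult Cmod_R (Rabs_pos_eq (2 * PI)); last lra.
  rewrite Rminus_0_r => H.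
  have -> : 2 * L / d * Cmod eta ^ 2 = 2 * L * Cmod eta ^ 2 / d by rewrite /Rdiv; ring.
  by apply: Rmult_le_reg_l H; lra.
exists c; apply/is_Cderive_eps => eps Heps.
have HLd : 0 <= 2 * L / d.
  by apply: Rmult_le_pos; [lra | apply: Rlt_le; exact: Rinv_0_lt_compat].
exists (Rmin d (eps / (2 * L / d + 1))); split.
  by apply: Rmin_glb_lt => //; apply: Rdiv_lt_0_compat; lra.
move=> w Hw.
have Hw1 := Rlt_le_trans _ _ _ Hw (Rmin_l _ _).
have Hw2 := Rlt_le_trans _ _ _ Hw (Rmin_r _ _).
have := key (w - a)%C Hw1.
have -> : (a + (w - a) = w)%C by ring.
move=> H; apply: Rle_trans H _.
have H0 := Cmod_ge_0 (w - a).
have : (2 * L / d + 1) * Cmod (w - a) <= eps.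
  have -> : eps = (2 * L / d + 1) * (eps / (2 * L / d + 1)) by field; lra.
  by apply: Rmult_le_compat_l; lra.
rewrite /=; nra.
Qed.

(** * The Schwarz-Pick inequality *)

Definition disk_map (phi : C -> C) : Prop :=
  analytic_on_disk phi /\ forall z, in_disk z -> in_disk (phi z).

Lemma holo_ball_disk (f : C -> C) (z : C) :
  analytic_on_disk f -> holo_ball f z (1 - Cmod z).
Proof.
move=> Hf w Hw; apply: Hf; rewrite /in_disk.
have := Cmod_sub_ge w z; lra.
Qed.

Lemma analytic_is_Cderive (f : C -> C) (z : C) :
  analytic_on_disk f -> in_disk z -> is_Cderive f z (C_derive f z).
Proof. by move=> Hf Hz; apply: (C_derive_correct _ _ (RtoC 0)); exact: Hf. Qed.

Lemma analytic_C_derive (f : C -> C) : analytic_on_disk f -> analytic_on_disk (C_derive f).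
Proof.
move=> Hf z Hz; apply: (ex_Cderive_C_derive f z (1 - Cmod z)); last exact: holo_ball_disk.
by rewrite /in_disk in Hz; lra.
Qed.

Lemma RtoC_neq_0 (x : R) : x <> 0 -> RtoC x <> RtoC 0.
Proof. by move=> Hx H; apply: Hx; case: H. Qed.

Lemma Cmod_lt_1_sqr (z : C) : in_disk z -> 0 < 1 - Cmod z ^ 2 <= 1.
Proof. rewrite /in_disk => H; have := Cmod_ge_0 z; simpl; nra. Qed.

Definition moebius (a z : C) : C := ((z - a) / (RtoC 1 - Cconj a * z))%C.

Lemma moebius_denominator_neq_0 (a z : C) :
  in_disk a -> Cmod z <= 1 -> (RtoC 1 - Cconj a * z)%C <> RtoC 0.
Proof.
rewrite /in_disk => Ha Hz; apply/Cmod_gt_0.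
have := Cmod_sub_ge (RtoC 1) (Cconj a * z); rewrite Cmod_1 Cmod_mult Cmod_conj.
have := Cmod_ge_0 a; have := Cmod_ge_0 z; nra.
Qed.

Lemma moebius_in_disk (a z : C) : in_disk a -> in_disk z -> in_disk (moebius a z).
Proof.
move=> Ha Hz; have Hz1 : Cmod z <= 1 by move: Hz; rewrite /in_disk; lra.
have Hd := moebius_denominator_neq_0 a z Ha Hz1.
rewrite /in_disk /moebius Cmod_div //; apply/Rlt_div_l; first exact/Cmod_gt_0.
rewrite Rmult_1_l.
have := Cmod_lt_1_sqr a Ha; have := Cmod_lt_1_sqr z Hz.
(* the identity behind the invariance of the disk *)
have E : Cmod (RtoC 1 - Cconj a * z) ^ 2 - Cmod (z - a) ^ 2 =
    (1 - Cmod a ^ 2) * (1 - Cmod z ^ 2).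
  by rewrite !Cmod2_alt; case: a Ha Hd => a1 a2 _ _; case: z Hz Hz1 => z1 z2 _ _ /=; ring.
move=> P1 P2.
have Hp : 0 < (1 - Cmod a ^ 2) * (1 - Cmod z ^ 2) by apply: Rmult_lt_0_compat; lra.
apply: Rnot_le_lt => Hle.
have := Cmod_ge_0 (RtoC 1 - Cconj a * z); simpl in *; nra.
Qed.

Lemma is_Cderive_moebius (a z : C) : in_disk a -> Cmod z <= 1 ->
  is_Cderive (moebius a) z
    (RtoC (1 - Cmod a ^ 2) / ((RtoC 1 - Cconj a * z) * (RtoC 1 - Cconj a * z)))%C.
Proof.
move=> Ha Hz.
have H := is_Cderive_div (fun w => w - a)%C (fun w => RtoC 1 - Cconj a * w)%C z _ _
  (moebius_denominator_neq_0 a z Ha Hz)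
  (is_Cderive_minus _ _ _ _ _ (is_Cderive_id z) (is_Cderive_const a z))
  (is_Cderive_minus _ _ _ _ _ (is_Cderive_const (RtoC 1) z)
    (is_Cderive_scal _ _ _ (Cconj a) (is_Cderive_id z))).
apply: is_Cderive_val H; congr Cdiv.
by rewrite RtoC_minus Cmod2_conj; ring.
Qed.

(** Cauchy's estimate on the circle of radius [r] gives [1 / r]; here [r] is
    chosen halfway between [1 / |G' 0|] and 1. *)
Lemma schwarz_at_0 (G : C -> C) : disk_map G -> Cmod (G (RtoC 0)) = 0 ->
  Cmod (C_derive G (RtoC 0)) <= 1.
Proof.
move=> [HG Hd] H0; apply: Rnot_lt_le => H1.
set D := Cmod _ in H1.
have HD : / D < 1 by rewrite -Rinv_1; apply: Rinv_lt_contravar; lra.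
have HD0 : 0 < / D by apply: Rinv_0_lt_compat; lra.
have := cauchy_estimate G (RtoC 0) 1 ((/ D + 1) / 2) 1.
have E (z : C) : (z - RtoC 0 = z)%C by ring.
move=> H; have : D <= 1 / ((/ D + 1) / 2).
  apply: H; last 1 first.
  - move=> z; rewrite E => Hz.
    apply: Rle_trans (Cmod_sub_le _ _) _; rewrite H0 Rplus_0_r.
    by apply: Rlt_le; apply: Hd; rewrite /in_disk Hz; lra.
  - by move=> z; rewrite E => Hz; exact: HG.
  - lra.
move/Rle_div_r => {}H; have := H ltac:(lra).
have -> : D * ((/ D + 1) / 2) = (1 + D) / 2 by field; lra.
lra.
Qed.

Lemma in_disk_0 : in_disk (RtoC 0).
Proof. by rewrite /in_disk Cmod_0; lra. Qed.

Lemma moebius_opp_0 (z : C) : moebius (- z) (RtoC 0) = z.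
Proof.
rewrite /moebius; have -> : (RtoC 1 - Cconj (- z) * RtoC 0 = RtoC 1)%C by ring.
by field.
Qed.

(** Moebius maps carrying 0 to [z] before [phi] and [phi z] to 0 after it reduce
    the claim to the case of a fixed point at 0. *)
Lemma schwarz_pick (phi : C -> C) (z : C) : disk_map phi -> in_disk z ->
  (1 - Cmod z ^ 2) * Cmod (C_derive phi z) <= 1 - Cmod (phi z) ^ 2.
Proof.
move=> [Ha Hd] Hz; set b := phi z.
have Hb : in_disk b by exact: Hd.
have Hmz : in_disk (- z)%C by rewrite /in_disk Cmod_opp.
pose G u := moebius b (phi (moebius (- z) u)).
have HG u : in_disk u -> exists l, is_Cderive G u l.
  move=> Hu; have Hm := moebius_in_disk _ _ Hmz Hu.
  eexists; apply: (is_Cderive_comp (moebius b) (fun u => phi (moebius (- z) u))).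
    by apply: is_Cderive_moebius => //; apply: Rlt_le; exact: Hd.
  apply: (is_Cderive_comp phi); first exact: analytic_is_Cderive.
  by apply: is_Cderive_moebius => //; exact: Rlt_le.
have GD : disk_map G.
  split; first by move=> u Hu; have [l Hl] := HG u Hu; exists l.
  by move=> u Hu; apply: moebius_in_disk => //; apply: Hd; exact: moebius_in_disk.
have P1 := Cmod_lt_1_sqr z Hz; have P2 := Cmod_lt_1_sqr b Hb.
have DG : is_Cderive G (RtoC 0)
    (/ RtoC (1 - Cmod b ^ 2) * (C_derive phi z * RtoC (1 - Cmod z ^ 2)))%C.
  have B1 : is_Cderive (moebius b) (phi (moebius (- z) (RtoC 0))) (/ RtoC (1 - Cmod b ^ 2))%C.
    rewrite moebius_opp_0 -/b.
    apply: is_Cderive_val (is_Cderive_moebius b b Hb (Rlt_le _ _ Hb)).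
    have -> : (RtoC 1 - Cconj b * b = RtoC (1 - Cmod b ^ 2))%C.
      by rewrite RtoC_minus Cmod2_conj; ring.
    by field; apply: RtoC_neq_0; lra.
  have B2 : is_Cderive (moebius (- z)) (RtoC 0) (RtoC (1 - Cmod z ^ 2)).
    have H01 : Cmod (RtoC 0) <= 1 by rewrite Cmod_0; lra.
    apply: is_Cderive_val (is_Cderive_moebius (- z) (RtoC 0) Hmz H01).
    rewrite Cmod_opp; have -> : (RtoC 1 - Cconj (- z) * RtoC 0 = RtoC 1)%C by ring.
    by field.
  have B3 : is_Cderive phi (moebius (- z) (RtoC 0)) (C_derive phi z).
    by rewrite moebius_opp_0; exact: analytic_is_Cderive.
  exact: is_Cderive_comp B1 (is_Cderive_comp phi (moebius (- z)) _ _ _ B3 B2).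
have G0 : Cmod (G (RtoC 0)) = 0.
  rewrite /G moebius_opp_0 -/b /moebius.
  have -> : (b - b = RtoC 0)%C by ring.
  by rewrite /Cdiv Cmult_0_l Cmod_0.
have := schwarz_at_0 G GD G0.
rewrite (is_C_derive_unique _ _ _ DG) !Cmod_mult Cmod_inv; last by apply: RtoC_neq_0; lra.
rewrite !Cmod_R !Rabs_pos_eq; try lra.
move=> H; have := Rmult_le_compat_l (1 - Cmod b ^ 2) _ _ ltac:(lra) H.
rewrite -Rmult_assoc Rinv_r; lra.
Qed.

Definition dilatation (h g : C -> C) (z : C) : C := (C_derive g z / C_derive h z)%C.

Lemma sense_preserving_derive_neq_0 (f h g : C -> C) (z : C) :
  sense_preserving_harmonic f h g -> in_disk z ->
  0 <= Cmod (C_derive g z) < Cmod (C_derive h z).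
Proof.
move=> [_ HJ] Hz; have := HJ z Hz; rewrite /jacobian.
have := Cmod_ge_0 (C_derive g z); have := Cmod_ge_0 (C_derive h z); simpl; nra.
Qed.

Lemma is_Cderive_dilatation (f h g : C -> C) (z : C) :
  sense_preserving_harmonic f h g -> in_disk z ->
  is_Cderive (dilatation h g) z ((C_derive2 g z * C_derive h z - C_derive g z * C_derive2 h z)
    / (C_derive h z * C_derive h z))%C.
Proof.
move=> Hf Hz; have [_ H] := sense_preserving_derive_neq_0 f h g z Hf Hz.
have [[Hh [Hg _]] _] := Hf.
apply: is_Cderive_div.
- by apply/Cmod_gt_0; have := Cmod_ge_0 (C_derive g z); lra.
- by apply: analytic_is_Cderive => //; exact: analytic_C_derive.
- by apply: analytic_is_Cderive => //; exact: analytic_C_derive.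
Qed.

Lemma dilatation_disk_map (f h g : C -> C) :
  sense_preserving_harmonic f h g -> disk_map (dilatation h g).
Proof.
move=> Hf; split => z Hz; first by eexists; exact: is_Cderive_dilatation Hf Hz.
have H := sense_preserving_derive_neq_0 f h g z Hf Hz.
rewrite /in_disk /dilatation Cmod_div; last by apply/Cmod_gt_0; lra.
apply/Rlt_div_l; lra.
Qed.

(** The difference is [- conj om * om' / (1 - |om|^2)] for the dilatation [om], to
    which the Schwarz-Pick inequality applies. *)
Lemma pre_schwarzian_approx (f h g : C -> C) (z : C) :
  sense_preserving_harmonic f h g -> in_disk z ->
  (1 - Cmod z ^ 2) * Cmod (pre_schwarzian h g z - C_derive2 h z / C_derive h z) <= 1.
Proof.
move=> Hf Hz; have H := sense_preserving_derive_neq_0 f h g z Hf Hz.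
have SP := schwarz_pick _ z (dilatation_disk_map f h g Hf) Hz.
have HJ := proj2 Hf z Hz.
rewrite (is_C_derive_unique _ _ _ (is_Cderive_dilatation f h g z Hf Hz)) in SP.
have Ha : C_derive h z <> RtoC 0 by apply/Cmod_gt_0; lra.
have EJ : RtoC (jacobian h g z) =
    (C_derive h z * Cconj (C_derive h z) - C_derive g z * Cconj (C_derive g z))%C.
  by rewrite /jacobian RtoC_minus !Cmod2_conj.
have HJ0 : RtoC (jacobian h g z) <> RtoC 0 by apply: RtoC_neq_0; lra.
have -> : (pre_schwarzian h g z - C_derive2 h z / C_derive h z)%C =
   (- (Cconj (C_derive g z) * C_derive h z *
     ((C_derive2 g z * C_derive h z - C_derive g z * C_derive2 h z)
      / (C_derive h z * C_derive h z)) / RtoC (jacobian h g z)))%C.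
  rewrite /pre_schwarzian EJ; field; split => //; by rewrite -EJ.
set w' := (_ / (C_derive h z * C_derive h z))%C in SP *.
clearbody w'.
rewrite Cmod_opp Cmod_div // !Cmod_mult Cmod_conj Cmod_R Rabs_pos_eq; last lra.
move: SP; rewrite /dilatation Cmod_div //.
set a := Cmod (C_derive h z) in H *; set b := Cmod (C_derive g z) in H *.
move=> SP.
have -> : jacobian h g z = a ^ 2 - b ^ 2 by [].
have HJ' : 0 < a ^ 2 - b ^ 2 by exact: HJ.
have -> : (1 - Cmod z ^ 2) * (b * a * Cmod w' / (a ^ 2 - b ^ 2)) =
  (b * a * ((1 - Cmod z ^ 2) * Cmod w')) / (a ^ 2 - b ^ 2) by rewrite /Rdiv; ring.
apply/Rle_div_l => //; rewrite Rmult_1_l.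
apply: Rle_trans (Rmult_le_compat_l (b * a) _ _ _ SP) _; first nra.
have -> : b * a * (1 - (b / a) ^ 2) = b / a * (a ^ 2 - b ^ 2) by field; lra.
have : b / a <= 1 by apply/Rle_div_l; lra.
nra.
Qed.

Lemma pre_schwarzian_le_norm (h g : C -> C) (n : R) :
  pre_schwarzian_norm h g = Finite n ->
  forall z, in_disk z -> (1 - Cmod z ^ 2) * Cmod (pre_schwarzian h g z) <= n.
Proof.
move=> E z Hz; have [H _] := Lub_Rbar_correct (fun r : R => exists z : C, in_disk z /\
    r = (1 - Cmod z ^ 2) * Cmod (pre_schwarzian h g z)).
move: H; rewrite -/(pre_schwarzian_norm h g) E => H.
by have := H _ (ex_intro _ z (conj Hz eq_refl)).
Qed.

Lemma pre_schwarzian_norm_le (h g : C -> C) (n : R) :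
  (forall z, in_disk z -> (1 - Cmod z ^ 2) * Cmod (pre_schwarzian h g z) <= n) ->
  Rbar_le (pre_schwarzian_norm h g) n.
Proof.
move=> H; apply: (proj2 (Lub_Rbar_correct _)) => r [z [Hz ->]].
exact: H.
Qed.

(** Evaluation at 0 excludes the value [m_infty]. *)
Lemma pre_schwarzian_norm_finite (h g : C -> C) :
  Rbar_lt (pre_schwarzian_norm h g) p_infty ->
  exists n, pre_schwarzian_norm h g = Finite n /\ 0 <= n.
Proof.
have [H _] := Lub_Rbar_correct (fun r : R => exists z : C, in_disk z /\
    r = (1 - Cmod z ^ 2) * Cmod (pre_schwarzian h g z)).
move: H; rewrite -/(pre_schwarzian_norm h g) => H.
have := H _ (ex_intro _ (RtoC 0) (conj in_disk_0 eq_refl)).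
case: (pre_schwarzian_norm h g) => [n||] //= H1 _; exists n; split => //.
apply: Rle_trans H1; apply: Rmult_le_pos (Cmod_ge_0 _).
rewrite Cmod_0; lra.
Qed.

Lemma analytic_part_bound (F H G : C -> C) (n : R) :
  sense_preserving_harmonic F H G ->
  (forall z, in_disk z -> (1 - Cmod z ^ 2) * Cmod (pre_schwarzian H G z) <= n) ->
  forall z, in_disk z -> (1 - Cmod z ^ 2) * Cmod (C_derive2 H z / C_derive H z) <= n + 1.
Proof.
move=> HF Hn z Hz; have A1 := pre_schwarzian_approx F H G z HF Hz; have A2 := Hn z Hz.
have P := Cmod_lt_1_sqr z Hz.
have := Cmod_sub_le (pre_schwarzian H G z) (pre_schwarzian H G z - C_derive2 H z / C_derive H z).
have -> : (pre_schwarzian H G z - (pre_schwarzian H G z - C_derive2 H z / C_derive H z) =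
  C_derive2 H z / C_derive H z)%C by ring.
move=> T; have := Rmult_le_compat_l (1 - Cmod z ^ 2) _ _ ltac:(lra) T; lra.
Qed.

Lemma pre_schwarzian_bound (f h g : C -> C) (m : R) :
  sense_preserving_harmonic f h g ->
  (forall z, in_disk z -> (1 - Cmod z ^ 2) * Cmod (C_derive2 h z / C_derive h z) <= m) ->
  forall z, in_disk z -> (1 - Cmod z ^ 2) * Cmod (pre_schwarzian h g z) <= m + 1.
Proof.
move=> Hf Hm z Hz; have A1 := pre_schwarzian_approx f h g z Hf Hz; have A2 := Hm z Hz.
have P := Cmod_lt_1_sqr z Hz.
have := Cmod_triangle (C_derive2 h z / C_derive h z)
  (pre_schwarzian h g z - C_derive2 h z / C_derive h z).
have -> : (C_derive2 h z / C_derive h z + (pre_schwarzian h g z - C_derive2 h z / C_derive h z) =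
  pre_schwarzian h g z)%C by ring.
move=> T; have := Rmult_le_compat_l (1 - Cmod z ^ 2) _ _ ltac:(lra) T; lra.
Qed.

(** By the chain rule [h'' / h' = phi' * (H'' / H') o phi], and Schwarz-Pick for
    [phi] absorbs the factor [phi'] into the weight. *)
Lemma subordination_bound (h H : C -> C) (m : R) :
  analytic_on_disk H -> (forall z, in_disk z -> C_derive H z <> RtoC 0) ->
  weakly_subordinate (C_derive h) (C_derive H) ->
  (forall z, in_disk z -> (1 - Cmod z ^ 2) * Cmod (C_derive2 H z / C_derive H z) <= m) ->
  forall z, in_disk z -> (1 - Cmod z ^ 2) * Cmod (C_derive2 h z / C_derive h z) <= m.
Proof.
move=> HH H0 [phi [Hphi [Hd E]]] Hm z Hz.
have Hpz := Hd z Hz.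
have D : is_Cderive (C_derive h) z (C_derive2 H (phi z) * C_derive phi z)%C.
  apply: (is_Cderive_ext_ball (fun w => C_derive H (phi w)) _ _ _ (1 - Cmod z)).
  - by move: Hz; rewrite /in_disk; lra.
  - by move=> w Hw; rewrite E //; have := Cmod_sub_ge w z; rewrite /in_disk; lra.
  - apply: is_Cderive_comp; last exact: analytic_is_Cderive.
    by apply: analytic_is_Cderive => //; exact: analytic_C_derive.
rewrite /C_derive2 (is_C_derive_unique _ _ _ D) E //.
have -> : (C_derive2 H (phi z) * C_derive phi z / C_derive H (phi z) =
  C_derive phi z * (C_derive2 H (phi z) / C_derive H (phi z)))%C.
  by field; exact: H0.
rewrite Cmod_mult -Rmult_assoc; apply: Rle_trans (Hm _ Hpz).
apply: Rmult_le_compat_r; first exact: Cmod_ge_0.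
exact: schwarz_pick.
Qed.

(** * Uniform local univalence *)

Lemma continuity_pt_Cmod_path (q : C -> C) (p : R -> C) (t : R) (v : C) :
  ex_Cderive q (p t) -> is_path_derive p t v ->
  continuity_pt (fun s => Cmod (q (p s))) t.
Proof.
move=> Hq Hp; apply/continuity_pt_filterlim.
have L := filterlim_comp _ _ _ _ _ _ _ _ (continuous_path_comp q p t v Hq Hp)
  (@filterlim_norm R_AbsRing C_R_NormedModule (q (p t))).
rewrite Cmod_norm; apply: filterlim_ext L => u; by rewrite Cmod_norm.
Qed.

(** If [m] is the maximum of [|q|] on the segment, then [q] varies by at most
    [m / 8] there, so [m <= |q z| + m / 8], that is [m <= 8/7 |q z|]. *)
Lemma small_growth_segment (q : C -> C) (z w : C) (A : R) :
  (forall t, 0 <= t <= 1 -> let u := (z + RtoC t * (w - z))%C in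
     ex_Cderive q u /\ Cmod (C_derive q u) <= A * Cmod (q u)) ->
  0 <= A -> A * Cmod (w - z) <= / 8 ->
  Cmod (q w - q z) <= / 7 * Cmod (q z).
Proof.
move=> H HA Hsmall; pose p t := (z + RtoC t * (w - z))%C.
have [t0 [Hmax Ht0]] := continuity_ab_maj (fun t => Cmod (q (p t))) 0 1 Rle_0_1
  (fun t Ht => continuity_pt_Cmod_path q p t _ (proj1 (H t Ht)) (is_path_derive_segment z (w - z) t)).
set m := Cmod (q (p t0)) in Hmax.
have Hwz := Cmod_ge_0 (w - z).
have Hm : 0 <= m := Cmod_ge_0 _.
have bound t : 0 <= t <= 1 -> Cmod (q (p t) - q z) <= / 8 * m.
  move=> Ht; have Ep : (p t - z = RtoC t * (w - z))%C by rewrite /p; ring.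
  apply: (Rle_trans _ (A * m * Cmod (p t - z))).
    apply: mean_value_segment => s Hs.
    have -> : (z + RtoC s * (p t - z) = p (s * t)%R)%C by rewrite Ep /p RtoC_mult; ring.
    have Hst : 0 <= s * t <= 1 by nra.
    have [H1 H2] := H _ Hst; split => //.
    by apply: Rle_trans H2 _; apply: Rmult_le_compat_l => //; exact: Hmax.
  rewrite Ep Cmod_mult Cmod_R Rabs_pos_eq; last lra.
  have : A * Cmod (w - z) * t <= / 8.
    have : 0 <= A * Cmod (w - z) by exact: Rmult_le_pos.
    nra.
  move=> X; have := Rmult_le_compat_r _ _ _ Hm X; lra.
have B0 := bound t0 Ht0.
have B1 := bound 1 ltac:(lra).
have E1 : p 1 = w by rewrite /p; ring.
rewrite E1 in B1.
have := Cmod_sub_ge (q (p t0)) (q z); rewrite -/m; lra.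
Qed.

(** [k + conj l] is the injective linear map [u |-> k' a * u] plus a term whose
    Lipschitz constant [K1 + K2] is less than [|k' a|]. *)
Lemma injective_of_derivative_bounds (k l : C -> C) (a : C) (r K1 K2 : R) :
  holo_ball k a r -> holo_ball l a r -> K1 + K2 < Cmod (C_derive k a) ->
  (forall z, Cmod (z - a) < r -> Cmod (C_derive k z - C_derive k a) <= K1) ->
  (forall z, Cmod (z - a) < r -> Cmod (C_derive l z) <= K2) ->
  forall z w, Cmod (z - a) < r -> Cmod (w - a) < r ->
    (k z + Cconj (l z) = k w + Cconj (l w))%C -> z = w.
Proof.
move=> Hk Hl HK H1 H2 z w Hz Hw E.
set c := C_derive k a in HK H1.
pose k0 u := (k u - c * u)%C.
have Dk u : Cmod (u - a) < r -> is_Cderive k0 u (C_derive k u - c)%C.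
  move=> Hu; apply: is_Cderive_minus.
    exact: C_derive_correct (RtoC 0) (Hk u Hu).
  by apply: is_Cderive_val (is_Cderive_scal _ _ _ _ (is_Cderive_id u)); ring.
have B1 : Cmod (k0 w - k0 z) <= K1 * Cmod (w - z).
  apply: (mean_value_ball k0 a r) => // u Hu; first by eexists; exact: Dk.
  by rewrite (is_C_derive_unique _ _ _ (Dk u Hu)); exact: H1.
have B2 : Cmod (l w - l z) <= K2 * Cmod (w - z) by exact: (mean_value_ball l a r).
have Ec : (c * (w - z) = - ((k0 w - k0 z) + Cconj (l w - l z)))%C.

  have : k w = (k z + Cconj (l z) - Cconj (l w))%C by rewrite E; ring.
  by rewrite /k0 => ->; rewrite Cminus_conj; ring.
have : Cmod c * Cmod (w - z) <= (K1 + K2) * Cmod (w - z).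
  rewrite -Cmod_mult Ec Cmod_opp.
  by apply: Rle_trans (Cmod_triangle _ _) _; rewrite Cmod_conj; lra.
move=> B; have Hwz := Cmod_ge_0 (w - z).
have Z : Cmod (w - z) = 0 by nra.
have -> : w = (z + (w - z))%C by ring.
by rewrite (Cmod_eq_0 _ Z); ring.
Qed.

Lemma ball_in_disk (a z : C) (s : R) :
  in_disk a -> 0 < s <= / 4 -> Cmod (z - a) < s * (1 - Cmod a ^ 2) ->
  in_disk z /\ (1 - Cmod a ^ 2) / 4 <= 1 - Cmod z ^ 2.
Proof.
rewrite /in_disk => Ha Hs Hz; have Hz0 := Cmod_ge_0 z; have Ha0 := Cmod_ge_0 a.
have := Cmod_sub_ge z a; simpl in *.
have E : 1 - Cmod a * (Cmod a * 1) = (1 - Cmod a) * (1 + Cmod a) by ring.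
rewrite E in Hz *.
set x := Cmod z in Hz Hz0 *; set y := Cmod a in Ha Ha0 Hz *.
move=> H.
have S1 : s * ((1 - y) * (1 + y)) <= / 4 * ((1 - y) * (1 + y)).
  by apply: Rmult_le_compat_r; [nra | lra].
have X : x <= y + (1 - y) * (1 + y) / 4 by lra.
have Y : x <= (1 + y) / 2 by nra.
split; first lra.
nra.
Qed.

Lemma artanh_le (x y : R) : 0 <= x -> x <= y -> y < 1 -> artanh x <= artanh y.
Proof.
move=> Hx Hxy Hy; rewrite /artanh; apply: Rmult_le_compat_l; first lra.
apply: ln_le; first by apply: Rdiv_lt_0_compat; lra.
apply/Rle_div_l; first lra.
have -> : (1 + y) / (1 - y) * (1 - x) = (1 + y) * (1 - x) / (1 - y) by rewrite /Rdiv; ring.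
apply/Rle_div_r; first lra.
nra.
Qed.

Lemma artanh_pos (x : R) : 0 < x < 1 -> 0 < artanh x.
Proof.
move=> Hx; rewrite /artanh; apply: Rmult_lt_0_compat; first lra.
rewrite -ln_1; apply: ln_increasing; first lra.
apply/Rlt_div_r; lra.
Qed.

(** From [|z - a| < s/2 |1 - conj a z|] and
    [|1 - conj a z| <= 1 - |a|^2 + |z - a|] one gets
    [(1 - s/2) |z - a| < s/2 (1 - |a|^2)], and [1 - s/2 >= 1/2]. *)
Lemma hyp_disk_in_ball (a z : C) (s : R) :
  in_disk a -> 0 < s <= 1 -> hyp_disk a (2 * artanh (s / 2)) z ->
  Cmod (z - a) < s * (1 - Cmod a ^ 2).
Proof.
move=> Ha Hs [Hz Hd]; have P := Cmod_lt_1_sqr a Ha.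
have Hm := moebius_in_disk a z Ha Hz.
have Hlt : Cmod (moebius a z) < s / 2.
  apply: Rnot_le_lt => Hle; move: Hd; apply: Rle_not_lt.
  apply: Rmult_le_compat_l; first lra.
  by apply: artanh_le => //; lra.
have Hden := moebius_denominator_neq_0 a z Ha (Rlt_le _ _ Hz).
move: Hlt; rewrite /moebius Cmod_div // => /Rlt_div_l; move/(_ (proj1 (Cmod_gt_0 _) Hden)) => Hlt.
have : Cmod (RtoC 1 - Cconj a * z) <= 1 - Cmod a ^ 2 + Cmod (z - a).
  have -> : (RtoC 1 - Cconj a * z = RtoC (1 - Cmod a ^ 2) - Cconj a * (z - a))%C.
    by rewrite RtoC_minus Cmod2_conj; ring.
  apply: Rle_trans (Cmod_sub_le _ _) _.
  rewrite Cmod_R Cmod_mult Cmod_conj Rabs_pos_eq; last lra.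
  have := Cmod_ge_0 (z - a); move: Ha; rewrite /in_disk; nra.
have := Cmod_ge_0 (z - a).
set x := Cmod (z - a) in Hlt *; nra.
Qed.

Lemma uniformly_locally_univalent_intro (f : C -> C) (rho : R) :
  0 < rho -> (forall a, in_disk a -> univalent_on (hyp_disk a rho) f) ->
  uniformly_locally_univalent f.
Proof.
move=> Hrho H; rewrite /uniformly_locally_univalent.
apply: (Rbar_lt_le_trans _ rho) => //.
apply: (proj2 (proj2_sig (Rbar_ex_glb _))) => _ [z [Hz ->]].
apply: (proj1 (Lub_Rbar_correct _)); split => //; exact: H.
Qed.

(** The radius is chosen so that, on the disk considered, [|k'' / k'|] times the
    radius is at most 1/8; this bounds the variation of [k'] by [|k' a| / 7] and
    the dilatation of [k + conj l] by 1/16, hence [|l'|] by [|k' a| / 14]. *)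
Lemma univalent_near_point (f h g : C -> C) (m : R) (a : C) :
  sense_preserving_harmonic f h g -> 0 <= m ->
  (forall z, in_disk z -> (1 - Cmod z ^ 2) * Cmod (C_derive2 h z / C_derive h z) <= m) ->
  in_disk a ->
  forall z w, Cmod (z - a) < / (32 * (m + 2)) * (1 - Cmod a ^ 2) ->
    Cmod (w - a) < / (32 * (m + 2)) * (1 - Cmod a ^ 2) -> f z = f w -> z = w.
Proof.
move=> Hf Hm Hbound Ha z w.
have [[Hh [Hg [_ Ef]]] _] := Hf.
set s := / _; set rho := 1 - Cmod a ^ 2; move=> Hz Hw E.
have Hrho : 0 < rho <= 1 by exact: Cmod_lt_1_sqr.
have Hs0 : 0 < s by apply: Rinv_0_lt_compat; lra.
have Es : s * (32 * (m + 2)) = 1 by rewrite /s; field; lra.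
have Hs : s <= / 64 by nra.
set om := dilatation h g.
have Hom : disk_map om := dilatation_disk_map f h g Hf.
set b := om a.
have Hb : in_disk b by exact: (proj2 Hom).
have ball u : Cmod (u - a) < s * rho -> in_disk u /\ rho / 4 <= 1 - Cmod u ^ 2.
  by apply: ball_in_disk => //; lra.
have H0 u : in_disk u -> C_derive h u <> RtoC 0.
  move=> Hu; have := sense_preserving_derive_neq_0 f h g u Hf Hu.
  by move=> X; apply/Cmod_gt_0; lra.
pose k u := (h u - Cconj b * g u)%C.
pose l u := (g u - b * h u)%C.
have Dk u : in_disk u -> is_Cderive k u (C_derive h u - Cconj b * C_derive g u)%C.
  move=> Hu; apply: is_Cderive_minus; first exact: analytic_is_Cderive.
  by apply: is_Cderive_scal; exact: analytic_is_Cderive.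
have Dl u : in_disk u -> is_Cderive l u (C_derive g u - b * C_derive h u)%C.
  move=> Hu; apply: is_Cderive_minus; first exact: analytic_is_Cderive.
  by apply: is_Cderive_scal; exact: analytic_is_Cderive.
have Hk : analytic_on_disk k by move=> u Hu; eexists; exact: Dk.
have Hl : analytic_on_disk l by move=> u Hu; eexists; exact: Dl.
have Ek u : in_disk u -> C_derive k u = (C_derive h u * (RtoC 1 - Cconj b * om u))%C.
  move=> Hu; rewrite (is_C_derive_unique _ _ _ (Dk u Hu)) /om /dilatation.
  by field; exact: H0.
have El u : in_disk u -> C_derive l u = (moebius b (om u) * C_derive k u)%C.
  move=> Hu; rewrite Ek // (is_C_derive_unique _ _ _ (Dl u Hu)) /moebius.
  have Hden := moebius_denominator_neq_0 b (om u) Hb (Rlt_le _ _ (proj2 Hom u Hu)).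
  have -> : C_derive g u = (om u * C_derive h u)%C.
    by rewrite /om /dilatation; field; exact: H0.
  by field.
have k0 u : in_disk u -> C_derive k u <> RtoC 0.
  move=> Hu; rewrite Ek //; apply: Cmult_neq_0; first exact: H0.
  by apply: moebius_denominator_neq_0 => //; apply: Rlt_le; exact: (proj2 Hom).
(* [k' = h' (1 - conj b * om)] adds the logarithmic derivative of
   [1 - conj b * om], of weighted modulus at most
   [(1 - |om|^2) / |1 - conj b * om| <= 2] *)
have growth u : in_disk u ->
    (1 - Cmod u ^ 2) * Cmod (C_derive (C_derive k) u) <= (m + 2) * Cmod (C_derive k u).
  move=> Hu.
  have D2 : is_Cderive (C_derive k) u
      (C_derive2 h u * (RtoC 1 - Cconj b * om u)
        + C_derive h u * (RtoC 0 - Cconj b * C_derive om u))%C.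
    apply: (is_Cderive_ext_ball (fun v => C_derive h v * (RtoC 1 - Cconj b * om v))%C
      _ _ _ (1 - Cmod u)).
    - by move: Hu; rewrite /in_disk; lra.
    - by move=> v Hv; rewrite Ek //; have := Cmod_sub_ge v u; rewrite /in_disk; lra.
    - apply: is_Cderive_mult.
        by apply: analytic_is_Cderive => //; exact: analytic_C_derive.
      apply: is_Cderive_minus; first exact: is_Cderive_const.
      by apply: is_Cderive_scal; apply: analytic_is_Cderive => //; exact: (proj1 Hom).
  rewrite (is_C_derive_unique _ _ _ D2) Ek // Cmod_mult.
  set e := (RtoC 1 - Cconj b * om u)%C.
  have SP := schwarz_pick om u Hom Hu.
  have HB := Hbound u Hu.
  have Ph : 0 < Cmod (C_derive h u) by apply/Cmod_gt_0; exact: H0.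
  rewrite Cmod_div in HB; last exact: H0.
  have {}HB : (1 - Cmod u ^ 2) * Cmod (C_derive2 h u) <= m * Cmod (C_derive h u).
    by apply/Rle_div_l => //; rewrite /Rdiv Rmult_assoc.
  have Homu : Cmod (om u) < 1 by exact: (proj2 Hom).
  have He : 1 - Cmod (om u) <= Cmod e.
    have := Cmod_sub_ge (RtoC 1) (Cconj b * om u).
    rewrite Cmod_1 Cmod_mult Cmod_conj -/e.
    have := Cmod_ge_0 (om u); move: Hb; rewrite /in_disk; nra.
  have Hom2 : 1 - Cmod (om u) ^ 2 <= 2 * Cmod e.
    have := Cmod_ge_0 (om u); simpl; nra.
  have P := Cmod_lt_1_sqr u Hu.
  have T : Cmod (C_derive2 h u * e + C_derive h u * (RtoC 0 - Cconj b * C_derive om u)) <=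
     Cmod (C_derive2 h u) * Cmod e + Cmod (C_derive h u) * Cmod (C_derive om u).
    apply: Rle_trans (Cmod_triangle _ _) _; rewrite !Cmod_mult.
    apply: Rplus_le_compat_l; apply: Rmult_le_compat_l; first lra.
    have -> : (RtoC 0 - Cconj b * C_derive om u = - (Cconj b * C_derive om u))%C by ring.
    rewrite Cmod_opp Cmod_mult Cmod_conj.
    have := Cmod_ge_0 (C_derive om u); move: Hb; rewrite /in_disk; nra.
  have {}T := Rmult_le_compat_l (1 - Cmod u ^ 2) _ _ ltac:(lra) T.
  have T1 := Rmult_le_compat_r _ _ _ (Cmod_ge_0 e) HB.
  have T2 := Rmult_le_compat_l _ _ _ (Rlt_le _ _ Ph) (Rle_trans _ _ _ SP Hom2).
  lra.
have aball : Cmod (a - a) < s * rho.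
  have -> : (a - a = RtoC 0)%C by ring.
  by rewrite Cmod_0; apply: Rmult_lt_0_compat; lra.
have Pk : 0 < Cmod (C_derive k a) by apply/Cmod_gt_0; exact: k0.
have seg u t : 0 <= t <= 1 -> Cmod (u - a) < s * rho ->
    Cmod (a + RtoC t * (u - a) - a) < s * rho.
  move=> Ht Hu; have -> : (a + RtoC t * (u - a) - a = RtoC t * (u - a))%C by ring.
  rewrite Cmod_mult Cmod_R Rabs_pos_eq; last lra.
  have := Cmod_ge_0 (u - a); nra.
(* [1 - |u|^2 >= rho / 4] turns the weighted bound into [4 (m + 2) / rho] *)
have near u : Cmod (u - a) < s * rho ->
    Cmod (C_derive k u - C_derive k a) <= / 7 * Cmod (C_derive k a).
  move=> Hu; apply: (small_growth_segment _ _ _ (4 * (m + 2) / rho)).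
  - move=> t Ht v; have [Hv Hv2] := ball v (seg u t Ht Hu).
    split; first exact: (analytic_C_derive k Hk v Hv).
    have -> : 4 * (m + 2) / rho * Cmod (C_derive k v) =
       ((m + 2) * Cmod (C_derive k v)) * (4 / rho) by field; lra.
    apply: Rle_trans (Rmult_le_compat_r (4 / rho) _ _ _ (growth v Hv)).
      have E1 : rho / 4 * (4 / rho) = 1 by field; lra.
      have P4 : 0 < 4 / rho by apply: Rdiv_lt_0_compat; lra.
      have : 1 <= (1 - Cmod v ^ 2) * (4 / rho).
        by rewrite -E1; apply: Rmult_le_compat_r; lra.
      have := Cmod_ge_0 (C_derive (C_derive k) v); nra.
    by apply: Rlt_le; apply: Rdiv_lt_0_compat; lra.
  - by apply: Rlt_le; apply: Rdiv_lt_0_compat; lra.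
  - have -> : / 8 = 4 * (m + 2) / rho * (s * rho).
      have -> : 4 * (m + 2) / rho * (s * rho) = (s * (32 * (m + 2))) / 8 by field; lra.
      by rewrite Es; lra.
    apply: Rmult_le_compat_l; last lra.
    by apply: Rlt_le; apply: Rdiv_lt_0_compat; lra.
(* the dilatation of [k + conj l] vanishes at [a] and is [4 / rho]-Lipschitz *)
have small u : Cmod (u - a) < s * rho -> Cmod (moebius b (om u)) <= / 16.
  move=> Hu.
  pose W v := moebius b (om v).
  have HW : disk_map W.
    split; last by move=> v Hv; apply: moebius_in_disk => //; exact: (proj2 Hom).
    move=> v Hv; eexists; apply: (is_Cderive_comp (moebius b)).
      by apply: is_Cderive_moebius => //; apply: Rlt_le; exact: (proj2 Hom).
    by apply: analytic_is_Cderive => //; exact: (proj1 Hom).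
  have W0 : W a = RtoC 0.
    by rewrite /W -/b /moebius; have -> : (b - b = RtoC 0)%C by [ring]; rewrite /Cdiv Cmult_0_l.
  have : Cmod (W u - W a) <= 4 / rho * Cmod (u - a).
    apply: mean_value_segment => t Ht.
    have [Hv Hv2] := ball _ (seg u t Ht Hu).
    set v := (a + _)%C in Hv Hv2 *.
    split; first exact: (proj1 HW).
    have SP := schwarz_pick W v HW Hv.
    apply/Rle_div_r; first lra.
    have := Cmod_ge_0 (C_derive W v); have := pow2_ge_0 (Cmod (W v)); nra.
  rewrite W0; have -> : (W u - RtoC 0 = W u)%C by ring.
  move=> X; apply: Rle_trans X _.
  have : 4 / rho * Cmod (u - a) <= 4 / rho * (s * rho).
    by apply: Rmult_le_compat_l; [apply: Rlt_le; apply: Rdiv_lt_0_compat; lra | lra].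
  have -> : 4 / rho * (s * rho) = 4 * s by field; lra.
  lra.
apply: (injective_of_derivative_bounds k l a (s * rho)
  (/ 7 * Cmod (C_derive k a)) (/ 14 * Cmod (C_derive k a))) => //.
- by move=> u Hu; apply: Hk; exact: proj1 (ball u Hu).
- by move=> u Hu; apply: Hl; exact: proj1 (ball u Hu).
- lra.
- move=> u Hu; rewrite El; last exact: proj1 (ball u Hu).
  rewrite Cmod_mult.
  have := near u Hu; have := small u Hu.
  have := Cmod_sub_ge (C_derive k u) (C_derive k a).
  have := Cmod_ge_0 (moebius b (om u)); have := Cmod_ge_0 (C_derive k u).
  nra.
- have X u : Cmod (u - a) < s * rho ->
      (k u + Cconj (l u) = f u - Cconj b * Cconj (f u))%C.
    move=> Hu; rewrite Ef; last exact: proj1 (ball u Hu).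
    by rewrite /k /l Cminus_conj Cmult_conj Cplus_conj Cconj_conj; ring.
  by rewrite !X // E.
Qed.

Theorem theorem9p2 :
  forall f h g F H G : C -> C,
    sense_preserving_harmonic f h g ->
    class_BH F H G ->
    weakly_subordinate (C_derive h) (C_derive H) ->
    Rbar_le (pre_schwarzian_norm h g) (Rbar_plus (pre_schwarzian_norm H G) (Finite 2)) /\
    uniformly_locally_univalent f.
Proof.
move=> f h g F H G Hf [[HF _] Hfin] Hsub.
have [n [En Hn]] := pre_schwarzian_norm_finite H G Hfin.
have HH : analytic_on_disk H by case: HF => [[]].
have H0 z : in_disk z -> C_derive H z <> RtoC 0.
  by move=> Hz; have X := sense_preserving_derive_neq_0 F H G z HF Hz; apply/Cmod_gt_0; lra.
have Bh := subordination_bound h H (n + 1) HH H0 Hsub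
  (analytic_part_bound F H G n HF (pre_schwarzian_le_norm H G n En)).
split.
  rewrite En /=; apply: pre_schwarzian_norm_le => z Hz.
  by have := pre_schwarzian_bound f h g (n + 1) Hf Bh z Hz; lra.
pose s := / (32 * (n + 1 + 2)).
have Hs : 0 < s by apply: Rinv_0_lt_compat; lra.
have Hs1 : s <= 1.
  by rewrite -Rinv_1; apply: Rinv_le_contravar; lra.
apply: (uniformly_locally_univalent_intro f (2 * artanh (s / 2))).
  by have := artanh_pos (s / 2); lra.
move=> a Ha z w Hz Hw.
apply: (univalent_near_point f h g (n + 1) a Hf _ Bh Ha); first lra.
- by apply: hyp_disk_in_ball.
- by apply: hyp_disk_in_ball.
Qed.
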